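(* Let $H$ be a $3$-uniform hypergraph that contains no linear cycle and does not contain the complete $3$-uniform hypergraph $K_5^3$ on five vertices as a subhypergraph. Then $H$ is $2$-colorable.
   Context: A $3$-uniform hypergraph $H=(V,E)$ consists of a (finite) vertex set $V$ and a set $E$ of hyperedges, each hyperedge being a $3$-element subset of $V$. $H$ is $k$-colorable if the vertices of $H$ can be colored with $k$ colors so that no hyperedge is monochromatic. A linear cycle of length $k\ge 3$ is an alternating sequence $v_1,h_1,v_2,h_2,\ldots,v_k,h_k$ of distinct vertices and distinct hyperedges such that $h_i\cap h_{i+1}=\{v_{i+1}\}$ for each $i\in\{1,\ldots,k-1\}$, $h_1\cap h_k=\{v_1\}$, and $h_i\cap h_j=\emptyset$ whenever $1<|j-i|<k-1$. $K_5^3$ is the hypergraph on $5$ vertices whose hyperedges are all $3$-element subsets of the vertex set. *)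

(* Defs.v *)
From mathcomp Require Import all_boot.

Set Implicit Arguments.
Unset Strict Implicit.
Unset Printing Implicit Defensive.

(* A hypergraph on the finite vertex set V is given by its set of hyperedges
   E : {set {set V}}. *)

Definition uniform (r : nat) (V : finType) (E : {set {set V}}) : Prop :=
  forall h : {set V}, h \in E -> #|h| = r.

Definition monochromatic (V : finType) (C : eqType) (c : V -> C)
    (h : {set V}) : Prop :=
  exists a : C, forall x : V, x \in h -> c x = a.

Definition colorable (k : nat) (V : finType) (E : {set {set V}}) : Prop :=
  exists c : V -> 'I_k, forall h : {set V}, h \in E -> ~ monochromatic c h.

(* The alternating sequence is indexed from 0 to k - 1.  In the last condition
   the subtraction is truncated, so only pairs i < j are constrained; as
   intersection is commutative, this covers all pairs with 1 < |j - i| < k - 1. *)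
Definition linear_cycle (V : finType) (E : {set {set V}}) (k : nat)
    (v : 'I_k -> V) (h : 'I_k -> {set V}) : Prop :=
  [/\ 3 <= k,
      injective v /\ injective h,
      forall i : 'I_k, h i \in E,
      (forall i j : 'I_k, j = i.+1 :> nat -> h i :&: h j = [set v j]) /\
      (forall i j : 'I_k, i = 0 :> nat -> j = k.-1 :> nat ->
         h i :&: h j = [set v i])
    & forall i j : 'I_k, 1 < j - i < k.-1 -> h i :&: h j = set0].

Definition has_linear_cycle (V : finType) (E : {set {set V}}) : Prop :=
  exists (k : nat) (v : 'I_k -> V) (h : 'I_k -> {set V}), linear_cycle E v h.

Definition complete_hypergraph (n r : nat) : {set {set 'I_n}} :=
  [set h : {set 'I_n} | #|h| == r].

(* Up to isomorphism and not necessarily induced. *)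
Definition contains_subhypergraph (V W : finType) (E : {set {set V}})
    (F : {set {set W}}) : Prop :=
  exists f : W -> V,
    injective f /\ forall h : {set W}, h \in F -> f @: h \in E.

(* Main.v *)
Require Import Defs.
From mathcomp Require Import all_boot.
From Stdlib Require Import Classical_Prop.

Set Implicit Arguments.
Unset Strict Implicit.
Unset Printing Implicit Defensive.

(** The proof enlarges the class of hypergraphs: edges may have size 2 or 3, and
    edges of size 2 may occur in linear cycles.  In this class one can take a
    counterexample E whose sum of edge sizes is minimal (splits_or), and
    minimality has three consequences.
    - Private edges (private_edge): for an edge e and a vertex v of e some edge
      meets e exactly in v.  Otherwise a colouring in which only e is
      monochromatic is repaired by recolouring v.
    - E is an antichain.
    - Detours: if stp is an edge, then replacing all the edges that contain s and
      t by the single edge st gives a lighter hypergraph that is at least as hard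
      to colour.  It has a linear cycle, which must use st, so E has a linear
      path with at least two edges from s to t.  Closing a detour by stp shows
      that p lies in its first or last edge (detour_first_last).  So
      some edge contains p and exactly one of s and t (detour_edge), and the pair
      st lies in at most three edges (codegree_le3).

    Consider a longest linear path, with end edge e.  At a vertex a of e outside
    the rest of the path, the private edge cannot prolong the path, so it returns
    to it; the only return that closes no linear cycle is along two vertices s, t
    of one edge dst of the path (tail_hit).  Then ast, dst and the path from a to
    d form an almost closed cycle.  By two_returns and the bound on codegrees,
    the edge after e is this edge dst, with d in e, and ast is an edge
    for every a in e other than d (end_edge).

    So the path ends with edges uxy and stu, where s is the root to which the rest
    of the path is attached, and stx and sty are edges too.  The private edge
    of stu at t has to be txy (tip_swap).  Hence the last two edges can be exchanged
    for other pairs on the same five vertices, and these exchanges reach all ten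
    triples (tip_complete): E contains the complete hypergraph on five vertices. *)

(** * Linear paths and linear cycles *)
Section LinearPaths.
Variable V : finType.
Implicit Types (x y z u d w p q s t : V) (e f g h F : {set V}).
Implicit Types (A B P : seq {set V}) (E : {set {set V}}).

(** The trivial path consists of its end vertex, so y is part of the support even when
    P is empty. *)
Fixpoint supp P y : {set V} := if P is e :: P' then e :|: supp P' y else [set y].

(** Linear paths from x to y with edge list P.  Each edge meets everything that follows,
    end vertex included, in its exit u alone; this makes consecutive edges share
    exactly u and all other pairs of edges disjoint. *)
Inductive lpath : V -> seq {set V} -> V -> Prop :=
| lpath_nil x : lpath x [::] x
| lpath_cons x e u P y : x \in e -> u \in e -> u != x ->
    (forall w, w \in e -> w \in supp P y -> w = u) ->
    lpath u P y -> lpath x (e :: P) y.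

Lemma lpath_inv x P y : lpath x P y ->
  match P with
  | [::] => x = y
  | e :: P' => exists u, [/\ x \in e, u \in e, u != x,
      forall w, w \in e -> w \in supp P' y -> w = u & lpath u P' y]
  end.
Proof. by case=> // {}x e u {}P {}y xe ue ux H Pu; exists u. Qed.

Lemma supp_end P y : y \in supp P y.
Proof. by elim: P => [|e P IH] /=; rewrite inE ?IH ?orbT. Qed.

Lemma supp_start x P y : lpath x P y -> x \in supp P y.
Proof. by case=> [z|z e u Q w ze *] /=; rewrite inE ?ze. Qed.

Lemma supp_mem e P y w : e \in P -> w \in e -> w \in supp P y.
Proof.
elim: P => //= f P IH; rewrite !inE => /orP[/eqP<- ->//|eP we].
by rewrite (IH eP we) orbT.
Qed.

Lemma start_notin x e P y : lpath x (e :: P) y -> x \notin supp P y.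
Proof.
case/lpath_inv=> u [xe ue ux H _]; apply/negP=> /(H _ xe) E.
by rewrite E eqxx in ux.
Qed.

Lemma supp_cat A B d y : d \in supp B y -> supp (A ++ B) y = supp A d :|: supp B y.
Proof.
move=> dB; elim: A => [|e A IH] /=; last by rewrite IH setUA.
by apply/setP=> w; rewrite !inE; case: eqP => // ->.
Qed.

Lemma lpath_cat x A d B y : lpath x A d -> lpath d B y ->
  (forall w, w \in supp A d -> w \in supp B y -> w = d) -> lpath x (A ++ B) y.
Proof.
elim=> [//|{}x e u P {}d xe ue ux H Pd IH] dB AB /=.
apply: (lpath_cons xe ue ux).
  move=> w we; rewrite (supp_cat _ (supp_start dB)) inE => /orP[/(H _ we)//|wB].
  have wd := AB w _ wB; rewrite /= inE we in wd.
  by apply: H => //; rewrite wd // supp_end.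
by apply: IH => // w wP wB; apply: AB => //=; rewrite inE wP orbT.
Qed.

Lemma lpath_split x A B y : lpath x (A ++ B) y -> exists d,
  [/\ lpath x A d, lpath d B y &
      forall w, w \in supp A d -> w \in supp B y -> w = d].
Proof.
elim: A x => [|e A IH] x /=.
  move=> H; exists x; split=> //; first exact: lpath_nil.
  by move=> w /=; rewrite inE => /eqP.
case/lpath_inv=> u [xe ue ux H /IH [d [Ad dB AB]]]; exists d; split=> //.
  apply: (lpath_cons xe ue ux) => // w we wA; apply: H => //.
  by rewrite (supp_cat _ (supp_start dB)) inE wA.
move=> w /=; rewrite inE => /orP[we|]; last exact: AB.
move=> wB; have wu : w = u.
  by apply: H => //; rewrite (supp_cat _ (supp_start dB)) inE wB orbT.
by subst w; apply: AB => //; apply: supp_start Ad.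
Qed.

Lemma lpath_one x e y : x \in e -> y \in e -> x != y -> lpath x [:: e] y.
Proof.
move=> xe ye xy; apply: (lpath_cons xe ye); first by rewrite eq_sym.
  by move=> w _ /=; rewrite inE => /eqP.
exact: lpath_nil.
Qed.

Lemma supp_rev x P y : lpath x P y -> supp (rev P) x = supp P y.
Proof.
elim=> // {}x e u Q {}y xe ue ux H Pd IH.
rewrite rev_cons -cats1 (@supp_cat _ _ u) /=; last by rewrite inE ue.
rewrite IH; apply/setP=> w; rewrite !inE.
by case: (w =P x) => [->|]; rewrite ?xe ?orbT ?orbF // orbC.
Qed.

Lemma lpath_rev x P y : lpath x P y -> lpath y (rev P) x.
Proof.
elim=> [z|{}x e u Q {}y xe ue ux H Pd IH]; first exact: lpath_nil.
rewrite rev_cons -cats1; apply: lpath_cat IH _ _; first exact: lpath_one.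
move=> w; rewrite (supp_rev Pd) => wQ /=; rewrite !inE => /orP[we|/eqP wx].
  exact: H.
by subst w; apply: H.
Qed.

(** The first edge is the only one that contains the start, and the last edge is the
    only one that contains the end. *)
Lemma lpath_both x P y h : lpath x P y -> h \in P -> x \in h -> y \in h -> P = [:: h].
Proof.
case: P => // e P Pxy; rewrite inE => /orP[/eqP->|hP] xh yh.
  case/lpath_inv: Pxy => u [_ _ _ H Pu].
  have E : y = u by apply: H yh (supp_end _ _).
  subst u; case: P Pu H => // g P Pu _.
  by have := start_notin Pu; rewrite supp_end.
by have := start_notin Pxy; rewrite (supp_mem _ hP xh).
Qed.

Lemma lpath_size x P y : lpath x P y -> size P < #|supp P y|.
Proof.
elim=> [z|{}x e u Q {}y xe ue ux H Pd IH] /=; first by rewrite cards1.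
apply: leq_ltn_trans IH _; apply: proper_card; apply/properP; split.
  exact: subsetUr.
exists x; first by rewrite inE xe.
by apply/negP=> xQ; rewrite (H _ xe xQ) eqxx in ux.
Qed.

(** Follow the path until it meets F for the first time: g is the edge where this
    happens, and d is the vertex through which g is entered. *)
Lemma first_hit F x P y : lpath x P y -> x \notin F ->
  (exists2 w, w \in F & w \in supp P y) ->
  exists A g B d, [/\ P = A ++ g :: B, lpath x A d, lpath d (g :: B) y,
    forall w, w \in supp A d -> w \notin F & exists2 w, w \in F & w \in g] /\
    (forall w, w \in supp A d -> w \in supp (g :: B) y -> w = d).
Proof.
elim=> [z|{}x e u Q {}y xe ue ux H Pd IH] xF [w wF].
  by rewrite /= inE => /eqP wz; rewrite -wz wF in xF.
move=> wP; case: (boolP [exists v, (v \in F) && (v \in e)]).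
  case/existsP=> v /andP[vF ve]; exists [::], e, Q, x; split; last first.
    by move=> v' /=; rewrite inE => /eqP.
  split=> //; [exact: lpath_nil|exact: lpath_cons Pd| |by exists v].
  by move=> v' /=; rewrite inE => /eqP->.
rewrite negb_exists => /forallP nF.
have {}nF v : v \in e -> v \notin F.
  by move=> ve; have := nF v; rewrite ve andbT.
have [||A [g [B [d [[E xA dB AF gF] AB]]]]] := IH; first exact: nF.
  exists w => //; move: wP => /=; rewrite inE => /orP[/nF|//].
  by rewrite wF.
subst Q; exists (e :: A), g, B, d; split; last first.
  move=> v; rewrite [supp _ _]/= inE => /orP[ve vB|]; last exact: AB.
  have E : v = u by apply: H => //; rewrite (supp_cat _ (supp_start dB)) inE vB orbT.
  by subst v; apply: AB => //; apply: supp_start xA.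
split=> //.
  apply: (lpath_cons xe ue ux) => // v ve vA; apply: H => //.
  by rewrite (supp_cat _ (supp_start dB)) inE vA.
by move=> v /=; rewrite inE => /orP[/nF|/AF].
Qed.

(** A linear cycle, presented as a linear path closed by one more edge g.  With at least
    two edges on the path, the cycle has length at least 3. *)
Definition lcycle E := exists p P q g,
  [/\ lpath p P q, {subset P <= E}, 2 <= size P, p != q & g \in E] /\
  [/\ p \in g, q \in g & forall w, w \in g -> w \in supp P q -> w = p \/ w = q].

(** Any edge h of a linear cycle can play the role of the closing edge: the other edges
    form a path between two vertices of h. *)
Lemma lcycle_rot E h p P q g :
  lpath p P q -> {subset P <= E} -> 2 <= size P -> p != q -> g \in E ->
  p \in g -> q \in g -> (forall w, w \in g -> w \in supp P q -> w = p \/ w = q) ->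
  h \in g :: P ->
  exists x y Q, [/\ lpath x Q y, 2 <= size Q, x \in h, y \in h & x != y] /\
    {subset Q <= E}.
Proof.
move=> Ppq PE sP pq gE pg qg gP; rewrite inE => /orP[/eqP->|hP].
  by exists p, q, P.
case/splitPr: hP Ppq PE sP gP => A B Ppq PE sP gP.
have [x [pA xB AB]] := lpath_split Ppq.
have [u [xh uh ux hB uq]] := lpath_inv xB.
have qB : q \in supp (h :: B) q by apply: supp_end.
have sE := supp_cat A (supp_start xB).
have xNB := start_notin xB.
have ABn w : w \in supp A x -> w \notin supp B q.
  move=> wA; apply/negP=> wB; have E1 : w = x by apply: AB; rewrite //= inE wB orbT.
  by rewrite E1 (negPf xNB) in wB.
have qA : q \notin supp A x by apply: contraL (supp_end B q); apply: ABn.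
have pB : p \notin supp B q by apply: ABn; apply: supp_start pA.
have gA w : w \in g -> w \in supp A x -> w = p.
  move=> wg wA; case: (gP w wg); rewrite ?sE ?inE ?wA // => wq.
  by rewrite wq (negPf qA) in wA.
have gB w : w \in g -> w \in supp B q -> w = q.
  move=> wg wB; case: (gP w wg); rewrite ?sE ?inE ?wB ?orbT // => wq.
  by rewrite wq (negPf pB) in wB.
have qgA : lpath q (g :: A) x by apply: (lpath_cons qg pg pq).
exists u, x, (B ++ g :: A); split; first split=> //.
- apply: lpath_cat uq qgA _ => w wB; rewrite /= inE => /orP[wg|wA].
    exact: gB.
  by have := ABn _ wA; rewrite wB.
- by move: sP; rewrite !size_cat /= addnC addSnnS.
move=> f; rewrite mem_cat inE => /or3P[fB|/eqP->//|fA]; apply: PE.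
  by rewrite mem_cat inE fB !orbT.
by rewrite mem_cat fA.
Qed.

(** The junctions vs of a path, with its two ends, in the indexed form in which linear
    cycles are defined. *)
Lemma lpath_junctions x P y : lpath x P y -> exists vs : seq V,
  [/\ size vs = (size P).+1, nth x vs 0 = x, nth x vs (size P) = y, uniq vs &
      {subset vs <= supp P y}] /\
  [/\ forall i, i < size P -> nth x vs i \in nth set0 P i,
      forall i, i < size P -> nth x vs i.+1 \in nth set0 P i,
      forall i w, i.+1 < size P ->
        w \in nth set0 P i -> w \in nth set0 P i.+1 -> w = nth x vs i.+1
    & forall i j w, j < size P -> i.+1 < j -> w \in nth set0 P i -> w \notin nth set0 P j].
Proof.
elim=> [z|{}x e u Q {}y xe ue ux H Pd [vs [[S1 S2 S3 S4 S5] [N1 N2 N3 N4]]]].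
  exists [:: z]; split; first by split=> //= w; rewrite !inE.
  by split=> // i j w; rewrite ltn0.
have nx i : i < size vs -> nth x vs i = nth u vs i by move=> ?; apply: set_nth_default.
exists (x :: vs); split; first split=> //=.
- by rewrite S1.
- by rewrite nx ?S1.
- rewrite S4 andbT; apply/negP=> /S5 xQ.
  by rewrite (H _ xe xQ) eqxx in ux.
- by move=> w; rewrite !inE => /orP[/eqP->|/S5->]; rewrite ?xe ?orbT.
split.
- by case=> [|i] //= iQ; rewrite nx ?N1 // S1 ltnS ltnW.
- case=> [|i] /= iQ; first by rewrite nx ?S2 // S1.
  by rewrite nx ?N2 // S1.
- case=> [|i] w /= iQ we.
    move=> wQ; rewrite nx ?S2 ?S1 //; apply: H => //.
    by apply: supp_mem wQ; apply: mem_nth.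
  by move=> wQ; rewrite (N3 i w iQ we wQ) nx // S1 ltnS ltnW.
case=> [|i] [|j] w //= jQ ij; last exact: N4.
move=> we; apply/negP=> wj.
have E : w = u by apply: H we (supp_mem _ (mem_nth _ jQ) wj).
case: Q Pd jQ wj {S1 S2 S3 S5 N1 N2 N3 N4 nx H} => // f Q Pd jQ wj.
case: j ij jQ wj => // j _ jQ wj.
have := start_notin Pd; rewrite -E (supp_mem y _ wj) //.
by apply: mem_nth.
Qed.

Lemma lcycle_has_linear_cycle E : lcycle E -> has_linear_cycle E.
Proof.
case=> p [P [q [g [[Ppq PE sP pq gE] [pg qg gP]]]]].
have [vs [[S1 S2 S3 S4 S5] [N1 N2 N3 N4]]] := lpath_junctions Ppq.
set l := size P in S1 S3 sP N1 N2 N3 N4.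
have l0 : 0 < l by apply: ltn_trans sP.
have [hh hP hg] : exists2 hh : nat -> {set V},
    forall i, i < l -> hh i = nth set0 P i & hh l = g.
  by exists (nth g P) => [i il|]; [apply: set_nth_default|rewrite nth_default].
have vinj i j : i <= l -> j <= l -> nth p vs i = nth p vs j -> i = j.
  by move=> ik jk /eqP; rewrite nth_uniq ?S1 // => /eqP.
(* The start p lies only in the first edge, the end q only in the last one. *)
have p0 : p \in nth set0 P 0 by rewrite -{1}S2 N1.
have pF i : i < l -> p \in nth set0 P i -> i = 0.
  case: i => [|[|i]] // il pi.
    have := N3 0 p il p0 pi; rewrite -{1}S2 => /vinj.
    by rewrite (ltnW il) => /(_ isT isT).
  by have := N4 0 i.+2 p il isT p0; rewrite pi.
have El : l = l.-1.+1 by rewrite prednK.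
have ql : q \in nth set0 P l.-1 by rewrite -S3 {1}El N2 // -El.
have qF i : i < l -> q \in nth set0 P i -> i.+1 = l.
  move=> il qi; apply/eqP; rewrite eqn_leq il leqNgt; apply/negP=> il'.
  have [il2|] := ltnP i.+1 l.-1.
    by have := N4 i l.-1 q; rewrite -El qi ql => /(_ (leqnn _) il2 isT).
  rewrite leq_eqVlt => /orP[/eqP li|]; last first.
    by rewrite -[_ < _]/(l.-1.+1 <= _) -El leqNgt il'.
  have := N3 i q il' qi; rewrite -li => /(_ ql); rewrite -{1}S3 => /vinj.
  by rewrite leqnn leq_pred => /(_ isT isT) E1; move: El; rewrite -E1 => /n_Sn.
have hinj i j : i < j -> j <= l -> hh i <> hh j.
  move=> ij; rewrite leq_eqVlt => /orP[/eqP jl|jl].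
    rewrite jl hg hP -?jl // => gi.
    have i0 : i = 0 by apply: pF; rewrite -?jl // gi.
    have := qF i; rewrite -jl gi => /(_ ij qg) E1.
    by move: sP; rewrite -jl -E1 i0.
  have il := ltn_trans ij jl; rewrite !hP // => E1.
  have [ij'|] := ltnP i.+1 j.
    by have := N4 i j _ jl ij' (N1 _ il); rewrite -E1 N1.
  move=> ji; have {ji} E2 : j = i.+1 by apply/eqP; rewrite eqn_leq ji.
  subst j; have := N3 i _ jl (N1 _ il); rewrite -E1 N1 // => /(_ isT) /vinj.
  by rewrite (ltnW il) (ltnW jl) => /(_ isT isT) /n_Sn.
exists l.+1, (fun i => nth p vs i), (fun i => hh i); split.
- by [].
- split=> i j.
    move=> E1; apply: val_inj; apply: vinj E1; rewrite -ltnS; exact: ltn_ord.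
  move=> E1; apply: val_inj; case: (ltngtP i j) => // ij; exfalso.
    by apply: (hinj _ _ ij) => //; rewrite -ltnS ltn_ord.
  by apply: (hinj _ _ ij) => //; rewrite -ltnS ltn_ord.
- move=> i; have := ltn_ord i; rewrite ltnS leq_eqVlt => /orP[/eqP->|il].
    by rewrite hg.
  by rewrite hP //; apply: PE; apply: mem_nth.
- split=> i j.
    move=> ji; have := ltn_ord j; rewrite ltnS leq_eqVlt => /orP[/eqP jl|jl].
      have il : i < l by apply: (@leq_trans j); [rewrite ji|rewrite jl].
      have li : i.+1 = l by rewrite -ji jl.
      rewrite jl hg hP // S3; apply/setP=> w; rewrite !inE.
      apply/andP/eqP=> [[wi wg]|->]; last first.
        by have := N2 i il; rewrite li S3 qg => ->.
      case: (gP w wg) => // [|wp]; first by apply: supp_mem wi; apply: mem_nth.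
      by rewrite wp in wi; have i0 := pF i il wi; rewrite -li i0 in sP.
    have il : i < l by apply: ltn_trans jl; rewrite ji.
    have il1 : i.+1 < l by rewrite -ji.
    rewrite !hP // ji; apply/setP=> w; rewrite !inE.
    by apply/andP/eqP=> [[wi wj]|->]; [apply: N3|rewrite N1 // N2].
  move=> i0 jl; rewrite i0 jl hg hP ?(ltn_trans _ sP) // S2.
  apply/setP=> w; rewrite !inE.
  apply/andP/eqP=> [[wi wg]|->]; last by rewrite pg -{1}S2 N1 ?(ltn_trans _ sP).
  case: (gP w wg) => // [|wq].
    by apply: supp_mem wi; apply: mem_nth; apply: ltn_trans sP.
  have := qF 0; rewrite -wq => /(_ (ltn_trans _ sP) wi) => /(_ isT) E1.
  by rewrite -E1 in sP.
move=> i j /andP[ij jl].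
rewrite ltn_subRL addn1 in ij.
have il : i < l by rewrite -ltnS; apply: leq_trans (ltn_ord j); apply: ltnW.
apply/setP=> w; rewrite !inE; apply/negP=> /andP[wi wj].
have := ltn_ord j; rewrite ltnS leq_eqVlt => /orP[/eqP jl'|jl'].
  rewrite jl' hg in wj; rewrite hP // in wi.
  case: (gP w wj) => [|wp|wq]; first by apply: supp_mem wi; apply: mem_nth.
    by rewrite jl' (pF i il) ?subn0 ?ltnn // -wp in jl.
  by have := qF i il; rewrite -wq wi => /(_ isT) E1; move: ij; rewrite jl' -{2}E1 ltnn.
by rewrite !hP // in wi wj; have := N4 i j w jl' ij wi; rewrite wj.
Qed.
End LinearPaths.

(** * Edges with three vertices *)
Section Triples.
Variable V : finType.
Implicit Types (x y z u d w p q s t a b c o : V) (e f g h F : {set V}).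
Implicit Types (A B P Q R : seq {set V}) (E : {set {set V}}).

Lemma card_set3 a b c : a != b -> a != c -> b != c -> #|[set a; b; c]| = 3.
Proof.
move=> ab ac bc.
by rewrite setUC cardsU1 cards2 ab !inE negb_or eq_sym ac eq_sym bc.
Qed.

Lemma eq_set3 g a b c : #|g| <= 3 -> a \in g -> b \in g -> c \in g ->
  a != b -> a != c -> b != c -> g = [set a; b; c].
Proof.
move=> g3 ag bg cg ab ac bc; apply/esym/eqP; rewrite eqEcard; apply/andP; split.
  by apply/subsetP=> w; rewrite !inE => /orP[/orP[]|] /eqP->.
by rewrite card_set3.
Qed.

Lemma in_set3 w a b c : w \in [set a; b; c] -> [\/ w = a, w = b | w = c].
Proof.
by rewrite !inE => /orP[/orP[]|] /eqP->; [constructor 1|constructor 2|constructor 3].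
Qed.

Lemma third_vertex e a b : #|e| = 3 -> exists o, [/\ o \in e, o != a & o != b].
Proof.
move=> e3; case: (boolP [exists o, [&& o \in e, o != a & o != b]]).
  by case/existsP=> o /and3P[oe oa ob]; exists o.
rewrite negb_exists => /forallP no.
have: e \subset [set a; b].
  apply/subsetP=> o oe; rewrite !inE; have := no o.
  by rewrite oe /= negb_and !negbK.
by move/subset_leq_card; rewrite e3 cards2; case: (a != b).
Qed.

(** The vertices are required to be distinct because edges of size 2 are around, and
    [set a; b; c] may degenerate to one. *)
Definition tri E a b c := [&& a != b, a != c, b != c & [set a; b; c] \in E].

Lemma triS E a b c : tri E a b c = tri E b a c.
Proof.
rewrite /tri [b == a]eq_sym [[set b; a; c]](_ : _ = [set a; b; c]); last first.
  by congr (_ :|: _); rewrite setUC.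
by case: (a != b); case: (a != c); case: (b != c).
Qed.

Lemma triR E a b c : tri E a b c = tri E a c b.
Proof.
rewrite /tri [c == b]eq_sym [[set a; c; b]]setUAC.
by case: (a != b); case: (a != c); case: (b != c).
Qed.

End Triples.

(** * Detours and codegrees in a critical hypergraph *)
Section Critical.
Variables (V : finType) (E : {set {set V}}).
Implicit Types (x y z u d w p q s t a b c o r : V) (e f g h F : {set V}).
Implicit Types (A B P Q R : seq {set V}).

(** The properties of a minimal counterexample, which force five vertices all of whose
    triples are edges. *)
Hypothesis Esize : forall e, e \in E -> 2 <= #|e| <= 3.
Hypothesis acyclic : ~ lcycle E.
Hypothesis antichain : forall e f, e \in E -> f \in E -> e \subset f -> e = f.
Hypothesis private : forall e v, e \in E -> v \in e -> exists2 f,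
  f \in E & v \in f /\ forall w, w \in f -> w \in e -> w = v.
Hypothesis detour : forall s t p, tri E s t p -> exists Q,
  [/\ lpath s Q t, {subset Q <= E} & 2 <= size Q].

Local Notation tri := (tri E).

Lemma le3 e : e \in E -> #|e| <= 3. Proof. by case/Esize/andP. Qed.

Lemma triP e a b c : e \in E -> a \in e -> b \in e -> c \in e ->
  a != b -> a != c -> b != c -> tri a b c.
Proof.
move=> eE ae be ce ab ac bc; rewrite /tri ab ac bc /=.
by rewrite -(@eq_set3 _ e) // le3.
Qed.

Lemma tri_edge a b c : tri a b c -> [set a; b; c] \in E.
Proof. by case/and4P. Qed.

Lemma edge_cover e a b c w : e \in E -> a \in e -> b \in e -> c \in e ->
  a != b -> a != c -> b != c -> w \in e -> [\/ w = a, w = b | w = c].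
Proof.
by move=> eE ae be ce ab ac bc; rewrite (@eq_set3 _ e a b c) ?le3 // => /in_set3.
Qed.

Lemma close P p q g : lpath p P q -> {subset P <= E} -> 2 <= size P ->
  p != q -> g \in E -> p \in g -> q \in g ->
  (forall w, w \in g -> w \in supp P q -> w = p \/ w = q) -> False.
Proof. by move=> *; apply: acyclic; exists p, P, q, g. Qed.

Lemma close_tri P s t p : lpath s P t -> {subset P <= E} -> 2 <= size P ->
  tri s t p -> p \notin supp P t -> False.
Proof.
move=> Pst PE sP T pP; case/and4P: (T) => st sp tp TE.
apply: (close Pst PE sP st TE); rewrite ?inE ?eqxx ?orbT // => w.
rewrite !inE => /orP[/orP[]|] /eqP->; [by left|by right|].
by rewrite (negPf pP).
Qed.

Lemma ends_apart Q s t h : lpath s Q t -> 2 <= size Q -> h \in Q -> s \in h -> t \notin h.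
Proof.
move=> Qst Q2 hQ sh; apply/negP=> th.
by move: Q2; rewrite (lpath_both Qst hQ sh th).
Qed.

(** If p is not on the detour, then stp closes it to a linear cycle; if the detour
    meets p first in an interior edge, then stp closes the part of it from s to p. *)
Lemma detour_first_last Q s t p : lpath s Q t -> {subset Q <= E} -> 2 <= size Q ->
  tri s t p -> p \in head set0 Q \/ p \in last set0 Q.
Proof.
move=> Qst QE sQ T; case/and4P: (T) => st sp tp _.
have pQ : p \in supp Q t by apply/negPn/negP=> /(close_tri Qst QE sQ T).
have sF : s \notin [set p] by rewrite inE.
have Fh : exists2 w, w \in [set p] & w \in supp Q t by exists p; rewrite ?inE.
have [A [g [B [d [[EQ sA dB pA [w wp pg]] AB]]]]] := first_hit Qst sF Fh.
move: wp pg; rewrite inE => /eqP-> pg.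
clear sF Fh; subst Q; case: A => [|e A] in Qst QE sQ pQ sA pA AB *; first by left.
case: B => [|f B] in Qst QE sQ pQ dB AB *.
  by right; rewrite last_cat.
have pd : p != d.
  by apply: contraTneq pg => pd; have := pA d (supp_end _ _); rewrite inE pd eqxx.
exfalso; apply: (@close_tri (e :: A ++ [:: g]) s p t).
- apply: (lpath_cat sA (lpath_one _ pg _)).
  + by case/lpath_inv: dB => v [].
  + by rewrite eq_sym.
  move=> v vA; rewrite /= !inE => /orP[vg|/eqP vp].
    by apply: AB; rewrite //= inE vg.
  by have := pA v vA; rewrite inE vp eqxx.
- move=> h hP; apply: QE; move: hP.
  rewrite -cat_cons !mem_cat !inE.
  by case/orP=> [->//|->]; rewrite orbT.
- by rewrite /= size_cat addn1.
- by rewrite triR.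
have tB : t \in supp (g :: f :: B) t by apply: supp_end.
have td : t != d by apply/eqP=> td; have := start_notin dB; rewrite -td supp_end.
have dg : d \in g by case/lpath_inv: dB => v [].
have dg' : d \in supp [:: g] p by rewrite /= inE dg.
rewrite -cat_cons (supp_cat _ dg') in_setU negb_or; apply/andP; split.
  by apply: contraNN td => tA; rewrite (AB t).
rewrite /= !inE negb_or tp andbT; case/lpath_inv: dB => v [_ vg vd H vB].
apply/negP=> tg; have tv : t = v by apply: H; rewrite // supp_end.
by subst v; have := start_notin vB; rewrite supp_end.
Qed.

Lemma last_mem x P y : lpath x P y -> 0 < size P ->
  last set0 P \in P /\ y \in last set0 P.
Proof.
elim=> [z //|{}x e u Q {}y xe ue ux H Pd IH] _.
case: Q Pd IH H => [/lpath_inv <- _ _|f Q Pd IH H]; first by rewrite inE.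
have [lQ yl] := IH isT; split; last exact: yl.
by rewrite inE; apply/orP; right; apply: lQ.
Qed.

Lemma head_mem x P y : lpath x P y -> 0 < size P ->
  head set0 P \in P /\ x \in head set0 P.
Proof. by case: P => // e P /lpath_inv[u [xe _ _ _ _]] _; rewrite inE eqxx. Qed.

Lemma detour_edge s t p : tri s t p -> exists2 g, g \in E &
  p \in g /\ (s \in g /\ t \notin g \/ t \in g /\ s \notin g).
Proof.
move=> T; have [Q [Qst QE sQ]] := detour T.
have Q0 : 0 < size Q by apply: ltn_trans sQ.
have [hQ sh] := head_mem Qst Q0; have [lQ tl] := last_mem Qst Q0.
case: (detour_first_last Qst QE sQ T) => pg.
  exists (head set0 Q); first exact: QE.
  by split=> //; left; split=> //; apply: ends_apart hQ sh.
exists (last set0 Q); first exact: QE.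
split=> //; right; split=> //; apply: contraL tl => sl.
exact: ends_apart lQ sl.
Qed.

(** The exit u of the first edge is no third vertex of the pair: stu would close the rest
    of the detour, which still has two edges.  So the first edge has room for one
    third vertex only. *)
Lemma long_detour_head s t Q p p' : lpath s Q t -> {subset Q <= E} -> 3 <= size Q ->
  tri s t p -> tri s t p' -> p \in head set0 Q -> p' \in head set0 Q -> p = p'.
Proof.
case: Q => // g Q Qst QE sQ T T' /= pg pg'.
have [u [sg ug us H uQ]] := lpath_inv Qst.
have nu q : tri s t q -> q != u.
  move=> Tq; apply/eqP=> qu; subst q.
  apply: (@close_tri Q u t s uQ _ sQ); last exact: start_notin Qst.
    by move=> h hQ; apply: QE; rewrite inE hQ orbT.
  by rewrite triS triR triS.
case/and4P: (T) => _ sp _ _; case/and4P: (T') => _ sp' _ _.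
have gE : g \in E by apply: QE; rewrite inE eqxx.
apply/eqP/negPn/negP=> pp'.
have := edge_cover gE sg ug pg _ sp _ pg'; rewrite eq_sym us eq_sym nu // => /(_ isT isT).
by case=> E1; [rewrite E1 eqxx in sp'|have := nu _ T'; rewrite E1 eqxx|rewrite E1 eqxx in pp'].
Qed.

Lemma long_detour s t Q p1 p2 p3 : lpath s Q t -> {subset Q <= E} -> 3 <= size Q ->
  tri s t p1 -> tri s t p2 -> tri s t p3 -> uniq [:: p1; p2; p3] -> False.
Proof.
move=> Qst QE sQ T1 T2 T3; rewrite /= !inE negb_or => /and3P[/andP[n12 n13] n23 _].
have hl := detour_first_last Qst QE (ltnW sQ).
have hh := long_detour_head Qst QE sQ.
have hr : head set0 (rev Q) = last set0 Q.
  by case/lastP: (Q) => // P' e; rewrite rev_rcons last_rcons.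
have ll p p' : tri s t p -> tri s t p' -> p \in last set0 Q -> p' \in last set0 Q -> p = p'.
  move=> Tp Tp' pl pl'; apply: (@long_detour_head t s (rev Q) p p').
  - exact: lpath_rev.
  - by move=> h; rewrite mem_rev => /QE.
  - by rewrite size_rev.
  - by rewrite triS.
  - by rewrite triS.
  - by rewrite hr.
  by rewrite hr.
case: (hl _ T1) (hl _ T2) (hl _ T3) => [] h1 [] h2 [] h3;
 by [have E1 := hh _ _ T1 T2 h1 h2; rewrite E1 eqxx in n12
    |have E1 := hh _ _ T1 T3 h1 h3; rewrite E1 eqxx in n13
    |have E1 := hh _ _ T2 T3 h2 h3; rewrite E1 eqxx in n23
    |have E1 := ll _ _ T1 T2 h1 h2; rewrite E1 eqxx in n12
    |have E1 := ll _ _ T1 T3 h1 h3; rewrite E1 eqxx in n13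
    |have E1 := ll _ _ T2 T3 h2 h3; rewrite E1 eqxx in n23].
Qed.

(** With three third vertices, the detour has only two edges: in a longer one the first and
    the last edge hold at most one third vertex each.  A detour with two edges sxu and
    tyu has room for x, u and y only. *)
Lemma codegree3 s t p1 p2 p3 :
  tri s t p1 -> tri s t p2 -> tri s t p3 -> uniq [:: p1; p2; p3] ->
  exists x u y, [/\ tri s x u, tri t u y &
    forall p, tri s t p -> [\/ p = x, p = u | p = y]].
Proof.
move=> T1 T2 T3 U; have [Q [Qst QE sQ]] := detour T1.
have hl := detour_first_last Qst QE sQ.
case: Q Qst QE sQ hl => // g [//|f [|k Q]] Qst QE _ /= hl; last first.
  by case: (long_detour Qst QE isT T1 T2 T3 U).
have [u [sg ug us H uQ]] := lpath_inv Qst.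
have [t' [uf tf tu _ /lpath_inv tt]] := lpath_inv uQ; subst t'.
have gE : g \in E by apply: QE; rewrite !inE eqxx.
have fE : f \in E by apply: QE; rewrite !inE eqxx orbT.
have gN p p' : tri s t p -> tri s t p' -> p != u -> p' != u -> p \in g -> p' \in g -> p = p'.
  move=> /and4P[_ sp _ _] /and4P[_ sp' _ _] pu pu' pg pg'; apply/eqP/negPn/negP=> pp'.
  have := edge_cover gE sg ug pg _ sp _ pg'; rewrite eq_sym us eq_sym pu => /(_ isT isT).
  by case=> E1; move: sp' pu' pp'; rewrite E1 eqxx.
have fN p p' : tri s t p -> tri s t p' -> p != u -> p' != u -> p \in f -> p' \in f -> p = p'.
  move=> /and4P[_ _ tp _] /and4P[_ _ tp' _] pu pu' pg pg'; apply/eqP/negPn/negP=> pp'.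
  have := edge_cover fE tf uf pg _ tp _ pg'; rewrite tu eq_sym pu => /(_ isT isT).
  by case=> E1; move: tp' pu' pp'; rewrite E1 eqxx.
have cls p : tri s t p -> [\/ p = u, p != u /\ p \in g | p != u /\ p \in f].
  move=> T; case: (eqVneq p u) => [->|pu]; first by constructor 1.
  by case: (hl _ T) => ?; [constructor 2|constructor 3].
suff [x [y [Tx Ty [xu xg] [yu yf]]]] : exists x y,
    [/\ tri s t x, tri s t y, x != u /\ x \in g & y != u /\ y \in f].
  exists x, u, y; split.
  - by case/and4P: Tx => _ sx _ _; apply: (triP gE); rewrite // eq_sym.
  - by case/and4P: Ty => _ _ ty _; apply: (triP fE); rewrite // eq_sym.
  move=> p Tp; case: (cls p Tp) => [->|[pu pg]|[pu pf]]; first by constructor 2.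
    by constructor 1; apply: gN.
  by constructor 3; apply: fN.
move: U; rewrite /= !inE negb_or => /and3P[/andP[n12 n13] n23 _].
(* By pigeonhole the three third vertices fall into three different classes. *)
case: (cls _ T1) (cls _ T2) (cls _ T3) =>
  [E1|[u1 i1]|[u1 i1]] [E2|[u2 i2]|[u2 i2]] [E3|[u3 i3]|[u3 i3]];
 first [ by subst p1; move: n12 n13; rewrite ?E2 ?E3 eqxx
       | by subst p2; move: n12 n23; rewrite ?E1 ?E3 eqxx
       | by have E0 := gN _ _ T1 T2 u1 u2 i1 i2; rewrite E0 eqxx in n12
       | by have E0 := gN _ _ T1 T3 u1 u3 i1 i3; rewrite E0 eqxx in n13
       | by have E0 := gN _ _ T2 T3 u2 u3 i2 i3; rewrite E0 eqxx in n23
       | by have E0 := fN _ _ T1 T2 u1 u2 i1 i2; rewrite E0 eqxx in n12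
       | by have E0 := fN _ _ T1 T3 u1 u3 i1 i3; rewrite E0 eqxx in n13
       | by have E0 := fN _ _ T2 T3 u2 u3 i2 i3; rewrite E0 eqxx in n23
       | by exists p1, p2 | by exists p2, p1 | by exists p1, p3 | by exists p3, p1
       | by exists p2, p3 | by exists p3, p2 ].
Qed.

Lemma codegree_le3 s t p1 p2 p3 p4 :
  tri s t p1 -> tri s t p2 -> tri s t p3 -> tri s t p4 -> uniq [:: p1; p2; p3; p4] -> False.
Proof.
move=> T1 T2 T3 T4 U.
have U3 : uniq [:: p1; p2; p3].
  exact: (@take_uniq _ _ 3 U).
have [x [u [y [_ _ N]]]] := codegree3 T1 T2 T3 U3.
have sub : {subset [:: p1; p2; p3; p4] <= [:: x; u; y]}.
  move=> p; rewrite !inE => /or4P[] /eqP->.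
  - by case: (N _ T1) => ->; rewrite eqxx ?orbT.
  - by case: (N _ T2) => ->; rewrite eqxx ?orbT.
  - by case: (N _ T3) => ->; rewrite eqxx ?orbT.
  - by case: (N _ T4) => ->; rewrite eqxx ?orbT.
by have := uniq_leq_size U sub.
Qed.

(** An edge of the detour through d contains s or t, and its third vertex is also a third
    vertex of the pair. *)
Lemma codegree_edge s t a b d :
  tri s t a -> tri s t b -> tri s t d -> uniq [:: a; b; d] ->
  exists r c, [/\ r = s \/ r = t, c = a \/ c = b & tri r d c].
Proof.
move=> Ta Tb Td U.
have [x [u [y [Tx Ty N]]]] := codegree3 Ta Tb Td U.
move: U; rewrite /= !inE negb_or => /and3P[/andP[ab ad] bd _].
case: (N _ Td) => Ed; subst d.
- exists s, u; split; [by left| |by []].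
  by case: (N _ Ta) (N _ Tb) => Ea [] Eb; subst; auto; rewrite eqxx in ab ad bd.
- case: (N _ Ta) => Ea; [|by rewrite Ea eqxx in ad|]; subst a.
    by exists s, x; split; [left|left|rewrite triR].
  by exists t, y; split; [right|left|].
exists t, u; split; [by right| |by rewrite triR].
by case: (N _ Ta) (N _ Tb) => Ea [] Eb; subst; auto; rewrite eqxx in ab ad bd.
Qed.


(** * Almost closed cycles *)

(** The path from p to q, closed up by pst and qst, is a cycle except that
    two of its edges share both s and t.  An edge g through s and p that avoids t and q
    can only be spz with z a vertex of the first edge r of the path, not its exit:
    if g meets the path in p alone, then g, the path and qst form a linear cycle;
    if g meets it after r, say in z, then g, the path from z on and qst do. *)
Lemma side_edge s t p q (r : {set V}) R g : tri p s t -> tri q s t ->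
  lpath p (r :: R) q -> {subset r :: R <= E} ->
  s \notin supp (r :: R) q -> t \notin supp (r :: R) q ->
  g \in E -> s \in g -> p \in g -> t \notin g -> q \notin g ->
  exists z, [/\ z \in g, z \in r, z != p, z != s & z \notin supp R q].
Proof.
move=> Tp Tq pRq RE sR tR gE sg pg tg qg.
have [ps pt st _] := and4P Tp; have [qs qt _ cE] := and4P Tq.
set c := [set q; s; t] in cE.
have [u [pr ur up H uR]] := lpath_inv pRq.
have cP v : v \in c -> [\/ v = q, v = s | v = t] by apply: in_set3.
have [qc sc] : q \in c /\ s \in c by rewrite !inE !eqxx orbT.
clearbody c.
have sR' : s \notin supp R q by apply: contra sR; rewrite /= inE => ->; rewrite orbT.
have tR' : t \notin supp R q by apply: contra tR; rewrite /= inE => ->; rewrite orbT.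
case: (boolP [exists w, (w \in g) && (w \in supp R q)]); last first.
  rewrite negb_exists => /forallP nR.
  case: (boolP [exists z, [&& z \in g, z \in r & z != p]]).
    case/existsP=> z /and3P[zg zr zp]; exists z; split=> //.
      by apply: contraNneq sR => <-; rewrite /= inE zr.
    by have := nR z; rewrite zg.
  rewrite negb_exists => /forallP nr; exfalso.
  apply: (@close (r :: R ++ [:: c]) p s g) => //.
  - rewrite -cat_cons; apply: (lpath_cat pRq (lpath_one qc sc qs)).
    move=> w wR; rewrite /= in_setU in_set1 => /orP[/cP[] //|/eqP] ws.
    + by rewrite ws (negPf sR) in wR.
    + by rewrite ws (negPf tR) in wR.
    by rewrite ws (negPf sR) in wR.
  - move=> h; rewrite -cat_cons mem_cat => /orP[/RE//|].
    by rewrite inE => /eqP->.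
  - by rewrite /= size_cat addn1.
  move=> w wg; rewrite -cat_cons (@supp_cat _ _ _ q); last by rewrite /= inE qc.
  rewrite /= !in_setU => /orP[/orP[wr|wR]|/orP[|]].
  - by left; apply/eqP; have := nr w; rewrite wg wr => /negbNE.
  - by have := nR w; rewrite wg wR.
  - case/cP=> ws; [|by right|].
    + by rewrite -ws wg in qg.
    by rewrite -ws wg in tg.
  by rewrite inE => /eqP; right.
(* Here g meets the path after r: walk back from q to the first edge h that meets g. *)
case/existsP=> w0 /andP[w0g w0R].
have Fh : exists2 w, w \in g & w \in supp (rev R) u.
  by exists w0; rewrite ?(supp_rev uR).
have [A [h [B [d [[ER qA dB Ag [w wg wh]] AB]]]]] := first_hit (lpath_rev uR) qg Fh.
have hP : lpath d [:: h] w.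
  case/lpath_inv: dB => v [dh _ _ _ _]; apply: lpath_one => //.
  by apply: contraTneq wg => <-; apply: Ag; apply: supp_end.
have qAh : lpath q (A ++ [:: h]) w.
  apply: (lpath_cat qA hP) => v vA; rewrite /= in_setU in_set1 => /orP[vh|/eqP vw].
    by apply: AB; rewrite //= inE vh.
  by have := Ag v vA; rewrite vw wg.
have dh : d \in h by case/lpath_inv: dB => v [].
have sE v : v \in supp (A ++ [:: h]) w = (v \in supp A d) || (v \in h).
  have dh' : d \in supp [:: h] w by rewrite /= inE dh.
  rewrite (supp_cat _ dh') /= !inE.
  by case: (v =P w) => [->|]; rewrite ?wh ?orbT ?orbF.
have sub v : v \in supp (A ++ [:: h]) w -> v \in supp R q.
  rewrite sE -(supp_rev uR) ER (supp_cat _ (supp_start dB)) /= !in_setU.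
  by case/orP=> ->; rewrite ?orbT.
have ws : s != w.
  by apply: contraNneq sR' => ->; apply: sub; rewrite sE wh orbT.
exfalso; apply: (@close (c :: A ++ [:: h]) s w g) => //.
- apply: (lpath_cons sc qc qs _ qAh) => v /cP[] // -> /sub.
    by rewrite (negPf sR').
  by rewrite (negPf tR').
- move=> k; rewrite inE => /orP[/eqP->//|kA].
  apply: RE; rewrite inE -mem_rev ER; apply/orP; right.
  by move: kA; rewrite !mem_cat !inE => /orP[]->; rewrite ?orbT.
- by rewrite /= size_cat addn1.
move=> v vg; rewrite /= in_setU => /orP[/cP[] vs|].
- by rewrite -vs vg in qg.
- by left.
- by rewrite -vs vg in tg.
move=> vR; right; move: vR (sub _ vR); rewrite sE => /orP[/Ag|vh vR].
  by rewrite vg.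
have wp : w != p.
  have /sub : w \in supp (A ++ [:: h]) w by apply: supp_end.
  by apply: contraTneq => ->; apply: start_notin pRq.
have sp : s != p by rewrite eq_sym.
have [] := edge_cover gE sg pg wg sp ws _ vg; rewrite // 1?eq_sym // => vs.
  by rewrite -vs vR in sR'.
by have := start_notin pRq; rewrite -vs vR.
Qed.

(** The third vertex z of the edge in side_edge would have to suit both paths.  If none
    does, then the edge that detour_edge provides at p must contain q. *)
Lemma two_returns s t p q (r : {set V}) R (r' : {set V}) R' : tri p s t -> tri q s t ->
  lpath p (r :: R) q -> {subset r :: R <= E} ->
  s \notin supp (r :: R) q -> t \notin supp (r :: R) q ->
  lpath p (r' :: R') q -> {subset r' :: R' <= E} ->
  s \notin supp (r' :: R') q -> t \notin supp (r' :: R') q ->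
  (forall z, z != p -> z \in r -> z \in r' ->
     z \notin supp R q -> z \notin supp R' q -> False) ->
  tri s p q \/ tri t p q.
Proof.
move=> Tp Tq P1 E1 s1 t1 P2 E2 s2 t2 nz.
have pq : p != q by apply/eqP=> pq; have := start_notin P1; rewrite pq supp_end.
have key s' t' g : tri p s' t' -> tri q s' t' ->
    s' \notin supp (r :: R) q -> t' \notin supp (r :: R) q ->
    s' \notin supp (r' :: R') q -> t' \notin supp (r' :: R') q ->
    g \in E -> s' \in g -> p \in g -> t' \notin g -> tri s' p q.
  move=> Tp' Tq' s1' t1' s2' t2' gE sg pg tg.
  have [ps _ _ _] := and4P Tp'; have [qs _ _ _] := and4P Tq'.
  case: (boolP (q \in g)) => qg; first by apply: (triP gE); rewrite // eq_sym.
  have [z [zg zr zp zs zR]] := side_edge Tp' Tq' P1 E1 s1' t1' gE sg pg tg qg.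
  have [z' [zg' zr' zp' zs' zR']] := side_edge Tp' Tq' P2 E2 s2' t2' gE sg pg tg qg.
  rewrite eq_sym in ps; rewrite eq_sym in zs; rewrite [z == p]eq_sym in zp.
  case: (edge_cover gE sg pg zg ps zs zp zg') => E3; subst z'.
  - by rewrite eqxx in zs'.
  - by rewrite eqxx in zp'.
  by case: (nz z).
have Tst : tri s t p by rewrite triR triS.
have [g gE [pg [[sg tg]|[tg sg]]]] := detour_edge Tst.
  by left; apply: (key s t g).
by right; apply: (key t s g) => //; rewrite triR.
Qed.

(** Let f leave the path at its end a and come back to it, first at the edge g.  If f met
    g in one vertex, f would close a linear cycle; so f contains the two vertices
    of g other than the one, d, through which g is reached from a. *)
Lemma tail_hit a e c P z f : e \in E -> a \in e -> c \in e -> a != c ->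
  (forall w, w \in e -> w \in supp P z -> w = c) -> lpath c P z ->
  {subset P <= E} -> f \in E -> a \in f -> (forall w, w \in f -> w \in e -> w = a) ->
  (forall w, w \in f -> w \notin supp P z) \/
  exists A g B d s t,
    [/\ P = A ++ g :: B, lpath c A d, lpath d (g :: B) z &
        forall w, w \in supp A d -> w \in supp (g :: B) z -> w = d] /\
    [/\ tri a s t, tri d s t, f = [set a; s; t] & g = [set d; s; t]].
Proof.
move=> eE ae ce ac eP cP PE fE af fe.
case: (boolP [exists w, (w \in f) && (w \in supp P z)]); last first.
  rewrite negb_exists => /forallP nP; left=> w wf.
  by have := nP w; rewrite wf.
case/existsP=> w0 /andP[w0f w0P]; right.
have cf : c \notin f by apply: contraNN ac => cf; rewrite (fe c cf ce).
have aP : a \notin supp P z by apply: contraNN ac => aP; rewrite (eP a).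
have [|A [g [B [d [[EP cA dB Af [w wf wg]] AB]]]]] := first_hit cP cf; first by exists w0.
exists A, g, B, d.
have gE : g \in E by apply: PE; rewrite EP mem_cat inE eqxx orbT.
have dg : d \in g by case/lpath_inv: dB => v [].
have sub v : v \in supp A d \/ v \in g -> v \in supp P z.
  by rewrite EP (supp_cat _ (supp_start dB)) /= !in_setU; case=> ->; rewrite ?orbT.
have ag : a \notin g by apply: contraNN aP => ag; apply: sub; right.
have df : d \notin f by apply: Af; apply: supp_end.
have aw : a != w by apply: contraNneq ag => ->.
have dw : d != w by apply: contraNneq df => ->.
case: (boolP [exists w', [&& w' \in f, w' \in g & w' != w]]).
  case/existsP=> v /and3P[vf vg vw]; exists w, v.
  have av : a != v by apply: contraNneq ag => ->.
  have dv : d != v by apply: contraNneq df => ->.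
  have wv : w != v by rewrite eq_sym.
  split=> //; split; first by apply: (triP fE).
  - by apply: (triP gE).
  - by apply: eq_set3; rewrite ?le3.
  by apply: eq_set3; rewrite ?le3.
rewrite negb_exists => /forallP nw; exfalso.
have cAg : lpath c (A ++ [:: g]) w.
  apply: (lpath_cat cA (lpath_one dg wg dw)) => v vA.
  rewrite /= in_setU in_set1 => /orP[vg|/eqP vw]; first by apply: AB; rewrite //= inE vg.
  by have := Af v vA; rewrite vw wf.
have sE v : v \in supp (A ++ [:: g]) w = (v \in supp A d) || (v \in g).
  have dg' : d \in supp [:: g] w by rewrite /= inE dg.
  rewrite (supp_cat _ dg') /= !inE.
  by case: (v =P w) => [->|]; rewrite ?wg ?orbT ?orbF.
apply: (@close (e :: A ++ [:: g]) a w f) => //.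
- apply: (lpath_cons ae ce _ _ cAg); first by rewrite eq_sym.
  by move=> v ve; rewrite sE => /orP vA; apply: eP => //; apply: sub.
- move=> h; rewrite inE => /orP[/eqP->//|hA]; apply: PE; rewrite EP.
  by move: hA; rewrite !mem_cat !inE => /orP[]->; rewrite ?orbT.
- by rewrite /= size_cat addn1.
move=> v vf; rewrite /= in_setU sE => /or3P[/(fe _ vf)|/Af|vg]; first by left.
  by rewrite vf.
by right; apply/eqP; have := nw v; rewrite vf vg => /negbNE.
Qed.

(** The junction between two parts of a path is determined by the lists of edges. *)
Lemma joint_unique c A d d' Q z : lpath c A d -> lpath c A d' ->
  d' \in supp Q z ->
  (forall w, w \in supp A d -> w \in supp Q z -> w = d) -> d' = d.
Proof.
move=> cA cA' d'Q AQ; case: A cA cA' AQ => [|e A] cA cA' AQ.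
  by move/lpath_inv: cA; move/lpath_inv: cA' => <-.
have [lA dl] := last_mem cA' isT; apply: AQ d'Q.
exact: supp_mem lA dl.
Qed.

(** * The end of a longest path *)
Lemma other_vertex e a : e \in E -> exists2 o, o \in e & o != a.
Proof.
move=> eE; case: (boolP [exists o, (o \in e) && (o != a)]).
  by case/existsP=> o /andP[oe oa]; exists o.
rewrite negb_exists => /forallP no; have /andP[e2 _] := Esize eE.
have: e \subset [set a].
  by apply/subsetP=> o oe; rewrite inE; have := no o; rewrite oe => /negbNE.
by move/subset_leq_card; rewrite cards1 leqNgt e2.
Qed.

(** The second alternative of tail_hit: an edge ast that meets e in a alone returns to the
    path P at its edge g. *)
Definition returns e c P z a A g B d s t : Prop :=
  [/\ P = A ++ g :: B, lpath c A d, lpath d (g :: B) z &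
      forall w, w \in supp A d -> w \in supp (g :: B) z -> w = d] /\
  [/\ tri a s t, tri d s t, g = [set d; s; t], s \notin e & t \notin e].

Section EndEdge.
(* The path under study is e followed by P, with c as their common vertex. *)
Variables (e : {set V}) (c : V) (P : seq {set V}) (z : V).
Hypotheses (eE : e \in E) (PE : {subset P <= E}) (cP : lpath c P z) (ce : c \in e).
Hypothesis eP : forall w, w \in e -> w \in supp P z -> w = c.

Lemma returns_path a A g B d s t : a \in e -> a != c -> returns e c P z a A g B d s t ->
  forall b, b \in e -> b != c ->
  [/\ lpath b (e :: A) d, {subset e :: A <= E},
      s \notin supp (e :: A) d, t \notin supp (e :: A) d &
      forall w, w \in supp A d -> w \in supp P z].
Proof.
move=> ae ac [[EP cA dB AB] [Ta Td Eg se te]] b be bc.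
have sub w : w \in supp A d -> w \in supp P z.
  by rewrite EP (supp_cat _ (supp_start dB)) in_setU => ->.
have [ds dt _ _] := and4P Td.
have [dg sg tg] : [/\ d \in g, s \in g & t \in g] by rewrite Eg !inE !eqxx !orbT.
split=> //.
- apply: (lpath_cons be ce _ _ cA); first by rewrite eq_sym.
  by move=> w we /sub; apply: eP.
- move=> h; rewrite inE => /orP[/eqP->//|hA].
  by apply: PE; rewrite EP mem_cat hA.
- rewrite /= inE negb_or se; apply/negP=> sA.
  by rewrite (AB s) ?eqxx //= ?inE ?sg in ds.
rewrite /= inE negb_or te; apply/negP=> tA.
by rewrite (AB t) ?eqxx //= ?inE ?tg in dt.
Qed.

(** If A is not empty, the path from b to d has at least two edges, and rdb closes it. *)
Lemma returns_chord a A g B d s t b r : a \in e -> a != c ->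
  returns e c P z a A g B d s t -> b \in e -> b != c ->
  r = s \/ r = t -> tri r d b -> A = [::].
Proof.
move=> ae ac ret be bc rst T; case: A ret => // h A ret; exfalso.
have [bA AE sA tA _] := returns_path ae ac ret be bc.
apply: (@close_tri (e :: h :: A) b d r bA AE isT); first by rewrite triS triR triS.
by case: rst => ->.
Qed.

(** Suppose that the edge f that leaves e at b returns earlier than the edge that leaves
    e at a.  Then two paths lead from a to d: the original one, which
    leaves e through c, and a second one, which leaves e through b and follows f.
    A third vertex for side_edge would be neither b nor c, but e has no other vertex
    than a, b, c.  So two_returns gives an edge through a and d, which returns_chord
    excludes. *)
Lemma returns_nested a b A g B d s t A' g' B' d' s' t' :
  a \in e -> a != c -> b \in e -> b != c -> a != b ->
  returns e c P z a A g B d s t -> returns e c P z b A' g' B' d' s' t' ->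
  size A' < size A -> False.
Proof.
move=> ae ac be bc ab ret ret' lt.
have [aA AE sA tA Asub] := returns_path ae ac ret ae ac.
have [bA' _ s'A' t'A' _] := returns_path be bc ret' be bc.
have [[EP cA dB AB] [Ta Td Eg se te]] := ret.
have [[EP' cA' dB' AB'] [Tb Td' Eg' se' te']] := ret'.
(* A and A' are both initial parts of P, and A' is the shorter one. *)
have [A2 EA] : exists A2, A = A' ++ g' :: A2.
  have: take (size A) P = A by rewrite EP take_size_cat.
  rewrite EP' take_cat ltnNge (ltnW lt) /= => <-.
  by case: (size A - size A') (subn_gt0 (size A') (size A)) => [|n] E1;
    [rewrite lt in E1|exists (take n B')].
subst A.
have [d1 [cA1 d1A2 A12]] := lpath_split cA.
have dsub w : w \in supp (g' :: A2) d -> w \in supp (g' :: B') z.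
  suff EB : B' = A2 ++ g :: B.
    rewrite EB -cat_cons (supp_cat _ (supp_start dB)) in_setU => ->//.
  by move: EP; rewrite EP' -catA cat_cons => /eqP; rewrite eqseq_cat // eqxx /= => /eqP [].
have [v [d1g' vg' vd1 g'A2 vA2]] := lpath_inv d1A2.
have d1d' : d1 = d'.
  by apply: (joint_unique cA' cA1 _ AB'); rewrite /= inE d1g'.
subst d1.
have A2P w : w \in supp A2 d -> w \in supp P z.
  move=> wA; apply: Asub; rewrite (supp_cat _ (supp_start d1A2)) /= !inE.
  by rewrite wA !orbT.
pose f := [set b; s'; t'].
have fE : f \in E by apply: tri_edge.
have fg' w : w \in f -> w = b \/ w \in g'.
  rewrite Eg' !inE => /orP[/orP[/eqP->|->]|->]; [by left| |]; right.
    by rewrite orbT.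
  by rewrite orbT.
have [ds' dt' _ _] := and4P Td'.
have vf : v \in f.
  by move: vg'; rewrite Eg' !inE (negPf vd1) /= => /orP[]->; rewrite ?orbT.
have bA2 : b \notin supp A2 d.
  by apply: contraNN bc => bA2; rewrite (eP be (A2P _ bA2)).
have bP : b \notin supp P z by apply: contraNN bc => bP; rewrite (eP be bP).
have g'P w : w \in g' -> w \in supp P z.
  by apply: supp_mem; rewrite EP' mem_cat inE eqxx orbT.
have bv : v != b by apply: contraNneq bP => <-; apply: g'P.
have bf : lpath b (f :: A2) d.
  apply: (lpath_cons _ vf bv _ vA2); first by rewrite !inE eqxx.
  by move=> w /fg'[->|wg']; [rewrite (negPf bA2)|apply: g'A2].
have fe w : w \in e -> w \in f -> w = b.
  move=> we; rewrite !inE => /orP[/orP[/eqP//|]|] /eqP ws.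
    by rewrite -ws we in se'.
  by rewrite -ws we in te'.
have bf0 : b \in f by rewrite !inE eqxx.
clearbody f.
have cA2 : c \notin supp A2 d.
  apply/negP=> cA2; have := A12 c (supp_start cA1).
  rewrite /= inE cA2 orbT => /(_ isT) E1; subst d'.
  by have := start_notin d1A2; rewrite cA2.
have aP2 : lpath a (e :: f :: A2) d.
  apply: (lpath_cons ae be _ _ bf); first by rewrite eq_sym.
  move=> w we; rewrite /= in_setU => /orP[/(fe _ we)//|wA2].
  by have wc := eP we (A2P _ wA2); rewrite -wc wA2 in cA2.
have sub2 w : w \in supp (e :: f :: A2) d -> w \in supp (e :: A' ++ g' :: A2) d.
  rewrite /= !in_setU (supp_cat _ (supp_start d1A2)) /= !in_setU.
  case/or3P=> [->//|/fg'[->|->]|->]; rewrite ?be ?orbT //.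
have E2 : {subset e :: f :: A2 <= E}.
  move=> h; rewrite !inE => /or3P[/eqP->//|/eqP->//|hA].
  by apply: AE; rewrite inE mem_cat inE hA !orbT.
have := two_returns Ta Td aA AE sA tA aP2 E2 (contra (sub2 s) sA) (contra (sub2 t) tA).
case=> [z' z'a z'e _ z'A z'f|T|T].
- have [z'a1|z'b|z'c] := edge_cover eE ae be ce ab ac bc z'e.
  + by rewrite z'a1 eqxx in z'a.
  + by rewrite z'b /= inE bf0 in z'f.
  by rewrite z'c (supp_start cA) in z'A.
- have := returns_chord ae ac ret ae ac (or_introl erefl) (_ : tri s d a).
  by rewrite triR => /(_ T); case: (A').
have := returns_chord ae ac ret ae ac (or_intror erefl) (_ : tri t d a).
by rewrite triR => /(_ T); case: (A').
Qed.

Hypothesis longest : forall x Q y, lpath x Q y -> {subset Q <= E} ->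
  size Q <= (size P).+1.

(** On a longest path the private edge of e at a does not prolong the path. *)
Lemma longest_returns a : a \in e -> a != c ->
  exists A g B d s t, returns e c P z a A g B d s t.
Proof.
move=> ae ac; have [f fE [af fe]] := private eE ae.
have aP : lpath a (e :: P) z by apply: (lpath_cons ae ce _ eP cP); rewrite eq_sym.
case: (tail_hit eE ae ce ac eP cP PE fE af fe) => [fP|].
  have [o of_ oa] := other_vertex a fE.
  have: size (f :: e :: P) <= (size P).+1.
    apply: (longest (x := o) (y := z)).
      apply: (lpath_cons of_ af _ _ aP); first by rewrite eq_sym.
      by move=> w wf; rewrite /= in_setU (negPf (fP _ wf)) orbF => /(fe _ wf).
    by move=> h; rewrite !inE => /or3P[/eqP->//|/eqP->//|/PE].
  by rewrite /= ltnn.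
case=> A [g [B [d [s [t [[EP cA dB AB] [Ta Td Ef Eg]]]]]]].
have [as_ at_ _ _] := and4P Ta.
exists A, g, B, d, s, t; split=> //; split=> //.
  by apply: contraNN as_ => se; rewrite eq_sym (fe s) // Ef !inE eqxx ?orbT.
by apply: contraNN at_ => te; rewrite eq_sym (fe t) // Ef !inE eqxx ?orbT.
Qed.

(** An end edge ac leaves no possible third vertex for side_edge.  The edge sad or tad left
    by two_returns closes the path from a to d if that has two edges, and contains
    e otherwise. *)
Lemma returns_card3 a A g B d s t : a \in e -> a != c ->
  returns e c P z a A g B d s t -> #|e| = 3.
Proof.
move=> ae ac ret; have [aA AE sA tA _] := returns_path ae ac ret ae ac.
have [[EP cA dB AB] [Ta Td Eg se te]] := ret.
apply/eqP; rewrite eqn_leq le3 // ltnNge; apply/negP=> e2.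
have Ee : e = [set a; c].
  apply/esym/eqP; rewrite eqEcard cards2 ac e2 andbT.
  by apply/subsetP=> w; rewrite !inE => /orP[]/eqP->.
have key r : r = s \/ r = t -> tri r a d -> False.
  move=> rst T; have EA := returns_chord ae ac ret ae ac rst (_ : tri r d a).
  rewrite triR in EA; have {}EA := EA T; subst A.
  have dc : c = d by apply: lpath_inv cA.
  have re : r \notin e by case: rst => ->.
  have E1 : e = [set r; a; d].
    apply: antichain => //; first exact: tri_edge T.
    by apply/subsetP=> w; rewrite Ee -dc !inE => /orP[]->; rewrite ?orbT.
  by move: re; rewrite {1}E1 !inE eqxx.
have := two_returns Ta Td aA AE sA tA aA AE sA tA; case.
- move=> w wa we _ wA _; move: we; rewrite Ee !inE (negPf wa) /= => /eqP wc.
  by rewrite wc (supp_start cA) in wA.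
- by apply: key; left.
by apply: key; right.
Qed.

(** By returns_nested all the vertices of e other than c return to the same edge dst, so
    the pair st has the third vertices x, b and d.  If dst were not next to e, then
    codegree_edge would join d to x or b by an edge that contradicts
    returns_chord. *)
Lemma end_edge : exists s t B,
  [/\ P = [set c; s; t] :: B, #|e| = 3, tri c s t &
      forall a, a \in e -> a != c -> tri a s t].
Proof.
have [x xe xc] := other_vertex c eE.
have [A [g [B [d [s [t ret]]]]]] := longest_returns xe xc.
have e3 := returns_card3 xe xc ret.
have all_ret b : b \in e -> b != c -> tri b s t.
  move=> be bc; case: (eqVneq x b) => [<-|xb].
    by case: ret => _ [].
  have [A' [g' [B' [d' [s' [t' ret']]]]]] := longest_returns be bc.
  have [[EP cA dB AB] [Tx Td Eg se te]] := ret.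
  have [[EP' cA' dB' AB'] [Tb Td' Eg' se' te']] := ret'.
  have sAA : size A = size A'.
    apply/eqP; rewrite eqn_leq !(leqNgt (size _)).
    rewrite eq_sym in xb.
    apply/andP; split; apply/negP.
      by apply: (returns_nested xe xc be bc _ ret ret'); rewrite eq_sym.
    exact: (returns_nested be bc xe xc xb ret' ret).
  move/eqP: (EP); rewrite EP' eqseq_cat // => /andP[/eqP EA /eqP[Eg0 _]].
  rewrite EA in cA'; rewrite Eg0 in dB' Eg'.
  have dd : d' = d.
    apply: (joint_unique cA cA' _ AB).
    by case/lpath_inv: dB' => v [d'g _ _ _ _]; rewrite /= in_setU d'g.
  subst d'; have fE := tri_edge Tb.
  have [bs bt st bE] := and4P Tb; have [ds dt _ _] := and4P Td.
  have [xs xt sst _] := and4P Tx.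
  have h w : w \in g -> d != w -> w \in [set b; s'; t'].
    by rewrite Eg' !inE [w == d]eq_sym => /orP[/orP[->//|->]|->]; rewrite ?orbT.
  have sg : s \in g by rewrite Eg !inE eqxx ?orbT.
  have tg : t \in g by rewrite Eg !inE eqxx ?orbT.
  have bs1 : b != s by apply: contraNneq se => <-.
  have bt1 : b != t by apply: contraNneq te => <-.
  apply: (triP fE _ (h s sg ds) (h t tg dt) bs1 bt1 sst).
  by rewrite !inE eqxx.
have [b [be bx bc]] := third_vertex x c e3.
have [[EP cA dB AB] [Tx Td Eg se te]] := ret.
have EA : A = [::].
  have [_ _ _ _ Psub] := returns_path xe xc ret xe xc.
  have nd y : y \in e -> y != c -> y != d.
    move=> ye; apply: contraNneq => yd; apply/eqP; apply: eP ye _.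
    by rewrite yd; apply: Psub; apply: supp_end.
  have U : uniq [:: x; b; d].
    by rewrite /= !inE negb_or eq_sym bx !nd.
  have Tb := all_ret b be bc.
  have rot y : tri y s t -> tri s t y by rewrite [tri s t y]triR triS.
  have [r [c' [rst c'xb T]]] := codegree_edge (rot _ Tx) (rot _ Tb) (rot _ Td) U.
  case: c'xb => Ec'; rewrite Ec' in T.
    exact: (returns_chord xe xc ret xe xc rst T).
  exact: (returns_chord xe xc ret be bc rst T).
subst A; have dc : c = d by apply: lpath_inv cA.
exists s, t, B; split=> //; first by rewrite EP dc Eg.
by rewrite dc.
Qed.
End EndEdge.


(** * From the end of a longest path to five complete vertices *)

(** B is a path from the root s that becomes a longest path when two edges are put before
    it.  The two edges vary: stu comes next to B, and the other one meets it
    in t or in u. *)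
Section Tip.
Variables (B : seq {set V}) (s z : V).
Hypotheses (sB : lpath s B z) (BE : {subset B <= E}).
Hypothesis longest : forall x Q y, lpath x Q y -> {subset Q <= E} ->
  size Q <= (size B).+2.

Lemma tip_path t u : tri s t u -> t \notin supp B z -> u \notin supp B z ->
  [/\ forall w, w \in [set s; t; u] -> w \in supp B z -> w = s,
      lpath t ([set s; t; u] :: B) z & {subset [set s; t; u] :: B <= E}].
Proof.
move=> T tB uB; have [st su tu e1E] := and4P T.
have e1B w : w \in [set s; t; u] -> w \in supp B z -> w = s.
  rewrite !inE => /orP[/orP[]|]/eqP-> //; first by rewrite (negPf tB).
  by rewrite (negPf uB).
split=> //; last by move=> k; rewrite inE => /orP[/eqP->//|/BE].
by apply: (lpath_cons _ _ st e1B sB); rewrite !inE eqxx ?orbT.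
Qed.

Lemma tip_end t u h : tri s t u -> t \notin supp B z -> u \notin supp B z ->
  h \in E -> t \in h -> (forall w, w \in h -> w \in [set s; t; u] -> w = t) ->
  (forall w, w \in h -> w \notin supp B z) ->
  #|h| = 3 /\ forall o, o \in h -> o != t -> tri o s u.
Proof.
move=> T tB uB hE th he1 hB; have [st su tu e1E] := and4P T.
have [e1B tP PE] := tip_path T tB uB.
have hP w : w \in h -> w \in supp ([set s; t; u] :: B) z -> w = t.
  by move=> wh; rewrite /= in_setU => /orP[/(he1 _ wh)//|wB]; rewrite (negPf (hB w wh)) in wB.
have [s' [t' [B' [[E1 _] h3 T' ho]]]] := end_edge hE PE tP th hP longest.
split=> // o oh ot; have To := ho o oh ot.
have f w : w \in [set s; t; u] -> w != t -> w \in [set o; s'; t'].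
  rewrite E1 !inE => /orP[/orP[/eqP->|->]|->]; rewrite ?orbT //.
  by rewrite eqxx.
have ne w : w \in [set s; t; u] -> o != w.
  by move=> we; apply: contraNneq ot => ow; apply/eqP; apply: he1 => //; rewrite ow.
have [s1 u1] : s \in [set s; t; u] /\ u \in [set s; t; u].
  by rewrite !inE !eqxx !orbT.
have ut : u != t by rewrite eq_sym.
apply: (triP (tri_edge To) _ (f s s1 st) (f u u1 ut) (ne s s1) (ne u u1) su).
by rewrite !inE eqxx.
Qed.

(** If h contained x but not y, then h, stu and uxy would form a linear triangle. *)
Lemma tip_third t u x y h : tri s t u -> tri u x y -> t != x -> t != y ->
  s != x -> s != y -> h \in E -> t \in h ->
  (forall w, w \in h -> w \in [set s; t; u] -> w = t) -> x \in h -> y \in h.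
Proof.
move=> T T2 tx ty sx sy hE th he1 xh; have [st su tu e1E] := and4P T.
have [ux uy xy e2E] := and4P T2.
apply/negPn/negP=> yh.
apply: (@close [:: [set s; t; u]; [set u; x; y]] t x h) => //.
- apply: (@lpath_cons _ _ _ u); rewrite ?inE ?eqxx ?orbT //; first by rewrite eq_sym.
    move=> w; rewrite !inE => /orP[/orP[]|]/eqP-> //.
      by rewrite (negPf su) (negPf sx) (negPf sy).
    by rewrite (negPf tu) (negPf tx) (negPf ty).
  by apply: lpath_one; rewrite ?inE ?eqxx ?orbT.
- by move=> k; rewrite !inE => /orP[]/eqP->.
move=> w wh; rewrite /= in_setU => /orP[/(he1 _ wh)|]; first by left.
rewrite in_setU => /orP[w2|].
  move: w2; rewrite !inE => /orP[/orP[]|]/eqP wx; last by rewrite -wx wh in yh.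
    by left; apply: he1; rewrite // wx !inE eqxx orbT.
  by right.
by rewrite inE => /eqP; right.
Qed.

(** The edges stx and sty come from the longest path with end uxy, stu.  For txy, let h be
    the private edge of stu at t.  If h contains x or y, then h = txy.  If h avoids the
    rest of the path, then h follows stu, but also stx, at the end of a longest path; this gives
    edges osu and o'sx with o and o' in h, and they form a linear triangle with uxy.
    If h returns to B, then stu and stx start two paths from t to which two_returns
    applies; the edge it gives closes a linear cycle or provides the pair st with a
    fourth third vertex. *)
Lemma tip_swap t u x y : tri s t u -> tri u x y -> t != x -> t != y ->
  s != x -> s != y ->
  t \notin supp B z -> u \notin supp B z -> x \notin supp B z -> y \notin supp B z ->
  [/\ tri s t x, tri s t y & tri t x y].
Proof.
move=> T T2 tx ty sx sy tB uB xB yB; have [st su tu e1E] := and4P T.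
have [ux uy xy e2E] := and4P T2.
have [x3 y3] : tri s t x /\ tri s t y.
  have T' : tri s u t by rewrite triR.
  have e2B w : w \in [set u; x; y] -> w \notin supp B z.
    by rewrite !inE => /orP[/orP[]|]/eqP->.
  have e12 w : w \in [set u; x; y] -> w \in [set s; u; t] -> w = u.
    rewrite !inE => /orP[/orP[]|]/eqP-> //.
      by rewrite [x == s]eq_sym [x == u]eq_sym [x == t]eq_sym (negPf sx) (negPf ux) (negPf tx).
    by rewrite [y == s]eq_sym [y == u]eq_sym [y == t]eq_sym (negPf sy) (negPf uy) (negPf ty).
  have u2 : u \in [set u; x; y] by rewrite !inE eqxx.
  have [_ H] := tip_end T' uB tB e2E u2 e12 e2B.
  by split; rewrite triR triS; apply: H; rewrite ?inE ?eqxx ?orbT // eq_sym.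
split=> //.
have te1 : t \in [set s; t; u] by rewrite !inE eqxx orbT.
have se1 : s \in [set s; t; u] by rewrite !inE eqxx.
have ue1 : u \in [set s; t; u] by rewrite !inE eqxx orbT.
have [h hE [th he1]] := private e1E te1.
case: (boolP (x \in h)) => xh.
  have yh := tip_third T T2 tx ty sx sy hE th he1 xh.
  exact: (triP hE).
case: (boolP (y \in h)) => yh.
  have T2' : tri u y x by rewrite triR.
  by have := tip_third T T2' ty tx sy sx hE th he1 yh; rewrite (negPf xh).
have hx w : w \in h -> w \in [set s; t; x] -> w = t.
  move=> wh; rewrite !inE => /orP[/orP[]|]/eqP wx //; last by rewrite -wx wh in xh.
  by apply: he1; rewrite // wx.
have ts : t != s by rewrite eq_sym.
have [e1B tP PE] := tip_path T tB uB.
have [e1xB tPx PEx] := tip_path x3 tB xB.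
exfalso; case: (tail_hit e1E te1 se1 ts e1B sB BE hE th he1) => [hB|].
  have [h3 hu] := tip_end T tB uB hE th he1 hB.
  have [_ hx3] := tip_end x3 tB xB hE th hx hB.
  have [o [oh ot _]] := third_vertex t t h3.
  have [o' [oh' ot' oo']] := third_vertex t o h3.
  have To := hu o oh ot; have To' := hx3 o' oh' ot'.
  have [os ou _ oE] := and4P To; have [os' ox' _ oE'] := and4P To'.
  have ho w : w \in h -> w != x /\ w != y.
    by move=> wh; split; apply: contraTneq wh => ->.
  have [ox oy] := ho _ oh; have [_ oy'] := ho _ oh'.
  have ou' : o' != u by apply: contraNneq ot' => E1; apply/eqP; apply: he1 => //; rewrite E1.
  apply: (@close [:: [set o; s; u]; [set u; x; y]] s x [set o'; s; x]) => //.
  - apply: (@lpath_cons _ _ _ u); rewrite ?inE ?eqxx ?orbT //; first by rewrite eq_sym.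
      move=> w; rewrite !inE => /orP[/orP[]|]/eqP-> //.
        by rewrite (negPf ou) (negPf ox) (negPf oy).
      by rewrite (negPf su) (negPf sx) (negPf sy).
    by apply: lpath_one; rewrite ?inE ?eqxx ?orbT.
  - by move=> k; rewrite !inE => /orP[]/eqP->.
  - by rewrite !inE eqxx orbT.
  - by rewrite !inE eqxx orbT.
  move=> w /in_set3[] ->; [|by left|by right].
  by rewrite /= !inE (negPf oo') (negPf os') (negPf ou') (negPf ox') (negPf oy').
case=> A [g [B' [d [s' [t' [[EB sA dB AB] [Tt Td Eh Eg]]]]]]].
have [ts' tt' _ _] := and4P Tt; have [ds dt _ _] := and4P Td.
have Asub w : w \in supp A d -> w \in supp B z.
  by rewrite EB (supp_cat _ (supp_start dB)) in_setU => ->.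
have key k : tri s t k -> k \notin supp B z ->
    (forall w, w \in h -> w \in [set s; t; k] -> w = t) ->
  [/\ lpath t ([set s; t; k] :: A) d, {subset [set s; t; k] :: A <= E},
    s' \notin supp ([set s; t; k] :: A) d & t' \notin supp ([set s; t; k] :: A) d].
  move=> Tk kB hk; have [kB' _ kE] := tip_path Tk tB kB; split.
  - apply: (@lpath_cons _ _ _ s); rewrite ?inE ?eqxx ?orbT //.
    by move=> w wk /Asub; apply: kB'.
  - by move=> f; rewrite inE => /orP[/eqP->|fA]; apply: kE;
      rewrite inE ?eqxx // EB mem_cat fA orbT.
  - rewrite /= in_setU negb_or; apply/andP; split.
      by apply: contraNN ts' => sk; rewrite eq_sym (hk s') // Eh !inE eqxx orbT.
    by apply/negP=> s'A; rewrite (AB s') ?eqxx //= ?inE ?Eg ?inE ?eqxx ?orbT in ds.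
  rewrite /= in_setU negb_or; apply/andP; split.
    by apply: contraNN tt' => sk; rewrite eq_sym (hk t') // Eh !inE eqxx orbT.
  by apply/negP=> s'A; rewrite (AB t') ?eqxx //= ?inE ?Eg ?inE ?eqxx ?orbT in dt.
have [P1 E1 s1 t1] := key u T uB he1; have [P2 E2 s2 t2] := key x x3 xB hx.
have fin r : r = s' \/ r = t' -> tri r t d -> False.
  move=> rst Tr.
  have rh : r \in h by rewrite Eh; case: rst => ->; rewrite !inE eqxx ?orbT.
  have rt : r != t by case/and4P: Tr.
  case: A sA {EB AB Asub key E2 s2 t2 P2} E1 P1 s1 t1 => [sA|k A _] E1 P1 s1 t1.
    have sd : s = d by apply: lpath_inv sA.
    rewrite -sd in Tr.
    apply: (@codegree_le3 s t u x y r) => //; first by rewrite triR triS triR.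
    have ru : u != r by apply: contraNneq rt => ur; apply/eqP; apply: he1 => //; rewrite -ur.
    have rx : x != r by apply: contraNneq xh => ->.
    have ry : y != r by apply: contraNneq yh => ->.
    by rewrite /= !inE !negb_or ux uy ru xy rx ry.
  apply: (@close_tri _ t d r P1 E1 isT); first by rewrite triR triS.
  by case: rst => ->.
have nz w : w != t -> w \in [set s; t; u] -> w \in [set s; t; x] ->
    w \notin supp A d -> w \notin supp A d -> False.
  move=> wt; rewrite !inE (negPf wt) !orbF => /orP[]/eqP->.
    by rewrite (supp_start sA).
  by rewrite eq_sym (negPf su) (negPf ux).
case: (two_returns Tt Td P1 E1 s1 t1 P2 E2 s2 t2 nz).
  by apply: fin; left.
by apply: fin; right.
Qed.

(** The lemma tip_swap applies to each pair of edges, one through s and one not, that meet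
    in one vertex and cover the five vertices; starting from stu and uxy it
    generates the remaining eight triples. *)
Lemma tip_complete t u x y : tri s t u -> tri u x y -> uniq [:: s; t; u; x; y] ->
  t \notin supp B z -> u \notin supp B z -> x \notin supp B z -> y \notin supp B z ->
  forall a b c, a \in [:: s; t; u; x; y] -> b \in [:: s; t; u; x; y] ->
    c \in [:: s; t; u; x; y] -> a != b -> a != c -> b != c -> tri a b c.
Proof.
move=> T1 T2 U tB uB xB yB.
move: U; rewrite /= !inE !negb_or -!andbA.
case/and5P=> st su sx sy /and5P[tu tx ty ux /and3P[uy xy _]].
have [T3 T4 T5] := tip_swap T1 T2 tx ty sx sy tB uB xB yB.
have perm p q r' : tri p q r' ->
    [/\ tri p r' q, tri q p r', tri q r' p, tri r' p q & tri r' q p].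
  move=> T; split; [by rewrite triR|by rewrite triS|by rewrite triR triS| |].
    by rewrite triS triR.
  by rewrite triS triR triS.
have [T1a _ _ _ _] := perm _ _ _ T1.
have [T6 T7 _] := tip_swap T1a T5 ux uy sx sy uB tB xB yB.
have [_ T2a _ T2b _] := perm _ _ _ T2.
have [_ _ T8] := tip_swap T3 T2a tu ty su sy tB xB uB yB.
have [_ _ T9] := tip_swap T4 T2b tu tx su sx tB yB uB xB.
have [T6a _ _ _ _] := perm _ _ _ T6.
have [_ T8a _ _ _] := perm _ _ _ T8.
have xt : x != t by rewrite eq_sym.
have [_ T10 _] := tip_swap T6a T8a xt xy st sy xB uB tB yB.
move=> a b c aU bU cU ab ac bc.
case/perm: (T1) => *; case/perm: (T2) => *; case/perm: (T3) => *; case/perm: (T4) => *.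
case/perm: (T5) => *; case/perm: (T6) => *; case/perm: (T7) => *; case/perm: (T8) => *.
case/perm: (T9) => *; case/perm: (T10) => *.
move: aU bU cU; rewrite !inE.
case/orP=> [|/or4P[]] /eqP Ea; case/orP=> [|/or4P[]] /eqP Eb;
  case/orP=> [|/or4P[]] /eqP Ec; subst a b c;
  by [rewrite eqxx in ab | rewrite eqxx in ac | rewrite eqxx in bc | assumption].
Qed.
End Tip.


(** The number k bounds how much longer than P a linear path can be. *)
Lemma exists_longest k x P y : lpath x P y -> {subset P <= E} ->
  #|V| <= size P + k ->
  exists x' P' y', [/\ lpath x' P' y', {subset P' <= E}, size P <= size P' &
    forall u Q v, lpath u Q v -> {subset Q <= E} -> size Q <= size P'].
Proof.
elim: k x P y => [|k IH] x P y Pxy PE.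
  rewrite addn0 => /(leq_trans (max_card (mem (supp P y)))).
  by rewrite leqNgt (lpath_size Pxy).
move=> kP; case: (classic (exists u Q v,
    [/\ lpath u Q v, {subset Q <= E} & size P < size Q])).
  case=> u [Q [v [uQ QE lt]]].
  have [|x' [P' [y' [H1 H2 H3 H4]]]] := IH u Q v uQ QE.
    by apply: leq_trans kP _; rewrite addnS -addSn leq_add2r.
  by exists x', P', y'; split=> //; apply: leq_trans H3; apply: ltnW.
move=> none; exists x, P, y; split=> // u Q v uQ QE; rewrite leqNgt.
by apply/negP=> lt; apply: none; exists u, Q, v.
Qed.

Lemma critical_complete : E != set0 -> exists U : seq V,
  [/\ uniq U, size U = 5 & forall a b c, a \in U -> b \in U -> c \in U ->
    a != b -> a != c -> b != c -> tri a b c].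
Proof.
case/set0Pn=> e0 e0E; have /andP[e02 _] := Esize e0E.
have /card_gt0P[x0 x0e] : 0 < #|e0| by apply: leq_trans e02.
have [y0 y0e yx0] := other_vertex x0 e0E; rewrite eq_sym in yx0.
have e0s : {subset [:: e0] <= E} by move=> k; rewrite inE => /eqP->.
have := exists_longest (lpath_one x0e y0e yx0) e0s (leq_addl _ _).
case=> x [[|e P] [z [Pxz PE // _ longest]]].
have eE : e \in E by apply: PE; rewrite inE eqxx.
have PE' : {subset P <= E} by move=> k kP; apply: PE; rewrite inE kP orbT.
have [c [xe ce cx eP cP]] := lpath_inv Pxz; rewrite eq_sym in cx.
have [s [t [B [EP e3 Tc Ta]]]] := end_edge eE PE' cP ce eP longest.
have [b [be bx bc]] := third_vertex x c e3.
have [v [cg vg vc gB vB]] : exists v, [/\ c \in [set c; s; t], v \in [set c; s; t],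
    v != c, forall w, w \in [set c; s; t] -> w \in supp B z -> w = v & lpath v B z].
  by rewrite EP in cP; apply: lpath_inv cP.
(* Of s and t, let s' be the vertex where the rest of the path begins. *)
have [s' [t' [Es' s'g t'g Tc' Ta']]] : exists s' t', [/\ s' = v, s' \in [set c; s; t],
    t' \in [set c; s; t], tri c s' t' & forall a, a \in e -> a != c -> tri a s' t'].
  have sg : s \in [set c; s; t] by rewrite !inE eqxx orbT.
  have tg : t \in [set c; s; t] by rewrite !inE eqxx orbT.
  case/in_set3: vg => Ev; first by rewrite Ev eqxx in vc.
    by exists s, t.
  by exists t, s; split=> // [|a ae ac]; rewrite triR // Ta.
have BE : {subset B <= E} by move=> k kB; apply: PE'; rewrite EP inE kB orbT.
have longest' u Q w : lpath u Q w -> {subset Q <= E} -> size Q <= (size B).+2.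
  by rewrite EP in longest; apply: longest.
have BP w : w \in supp B z -> w \in supp P z by rewrite EP /= in_setU => ->; rewrite orbT.
have eB a : a \in e -> a \notin supp B z.
  move=> ae; apply/negP=> aB; have ac := eP a ae (BP a aB).
  rewrite EP in cP; have := start_notin cP; by rewrite -ac aB.
have [cs' ct' st' _] := and4P Tc'; have [xs' xt' _ _] := and4P (Ta' x xe cx).
have [bs' bt' _ _] := and4P (Ta' b be bc).
have t'B : t' \notin supp B z.
  by apply: contraNN st' => t'B; rewrite (gB t') // Es'.
rewrite -Es' in vB.
have T1 : tri s' t' c by rewrite triR triS.
have T2 : tri c x b by apply: (triP eE); rewrite // eq_sym.
have U : uniq [:: s'; t'; c; x; b].
  rewrite /= !inE !negb_or st' /= ![s' == _]eq_sym ![t' == _]eq_sym.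
  by rewrite cs' xs' bs' ct' xt' bt' ![c == _]eq_sym cx bc eq_sym bx.
exists [:: s'; t'; c; x; b]; split=> //.
exact: (tip_complete vB BE longest' T1 T2 U t'B (eB c ce) (eB x xe) (eB b be)).
Qed.

End Critical.

(** * Minimal counterexamples *)
Section Reduction.
Variable V : finType.
Implicit Types (E : {set {set V}}) (S e : {set V}).

(** S and its complement are the colour classes. *)
Definition splits S E := forall e, e \in E -> ~~ (e \subset S) && ~~ (e \subset ~: S).

Definition has_complete E := exists U : seq V,
  [/\ uniq U, size U = 5 & forall a b c, a \in U -> b \in U -> c \in U ->
    a != b -> a != c -> b != c -> tri E a b c].

Definition weight E := \sum_(e in E) #|e|.

Lemma lcycle_sub E E' : {subset E' <= E} -> lcycle E' -> lcycle E.
Proof.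
move=> sub [p [P [q [g [[H1 H2 H3 H4 H5] H6]]]]]; exists p, P, q, g.
by split=> //; split=> // [k /H2 /sub|]; [|apply: sub].
Qed.

Lemma has_complete_sub E E' : (forall e, e \in E' -> #|e| = 3 -> e \in E) ->
  has_complete E' -> has_complete E.
Proof.
move=> sub [U [H1 H2 H3]]; exists U; split=> // a b c aU bU cU ab ac bc.
have /and4P[_ _ _ eE'] := H3 a b c aU bU cU ab ac bc.
by rewrite /tri ab ac bc /=; apply: sub; rewrite ?card_set3.
Qed.

(** Take a colouring of the other edges; e lies in one class S.  Moving v to the
    other class repairs e, so it spoils some edge f, which then has v as its only
    vertex in S. *)
Lemma private_edge E e v : (forall f, f \in E -> 2 <= #|f|) -> e \in E -> v \in e ->
  ~ (exists S, splits S E) -> (exists S, splits S (E :\ e)) ->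
  exists2 f, f \in E & v \in f /\ forall w, w \in f -> w \in e -> w = v.
Proof.
move=> E2 eE ve nE [S0 S0E].
(* Up to exchanging the two classes, e lies in S. *)
have [S SE eS] : exists2 S, splits S (E :\ e) & e \subset S.
  case: (boolP (e \subset S0)) => [eS|neS]; first by exists S0.
  case: (boolP (e \subset ~: S0)) => [eS|neS']; last first.
    case: nE; exists S0 => f fE; case: (eqVneq f e) => [->|fe]; first by rewrite neS.
    by apply: S0E; rewrite !inE fe.
  by exists (~: S0) => // f /S0E; rewrite setCK andbC.
have [f] : exists f : {set V}, ~~ ((f \in E) ==>
    ~~ (f \subset S :\ v) && ~~ (f \subset ~: (S :\ v))).
  apply/existsP; rewrite -negb_forall; apply/negP=> /forallP H; apply: nE.
  by exists (S :\ v) => k kE; have := H k; rewrite kE.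
rewrite negb_imply negb_and !negbK => /andP[fE].
case: (eqVneq f e) => [->|fe].
  case/orP=> /subsetP H; first by have := H v ve; rewrite !inE eqxx.
  have [w we wv] : exists2 w, w \in e & w != v.
    have : ~~ (e \subset [set v]).
      by apply/negP=> /subset_leq_card; rewrite cards1 leqNgt E2.
    by case/subsetPn=> w we; rewrite inE; exists w.
  by have := H w we; rewrite !inE wv (subsetP eS).
have /andP[fS fS'] : ~~ (f \subset S) && ~~ (f \subset ~: S) by apply: SE; rewrite !inE fe.
case/orP=> H.
  by move: fS; rewrite (subset_trans H) // subsetDl.
have fv w : w \in f -> w \in S -> w = v.
  move=> wf wS; apply/eqP; have := subsetP H w wf.
  by rewrite !inE wS andbT negbK.
exists f => //; split; last by move=> w wf we; apply: fv => //; apply: (subsetP eS).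
by case/subsetPn: fS' => w wf; rewrite inE negbK => wS; rewrite -(fv w).
Qed.

(** Strong induction on the weight; n bounds it. *)
Lemma splits_or E n : (forall e, e \in E -> 2 <= #|e| <= 3) -> weight E < n ->
  ~ lcycle E -> ~ has_complete E -> exists S, splits S E.
Proof.
elim: n E => // n IH E Esz; rewrite ltnS => En acyc nK.
case: (classic (exists S, splits S E)) => // nS; exfalso.
have lt E' : (forall e, e \in E' -> 2 <= #|e| <= 3) -> weight E' < weight E ->
    ~ lcycle E' -> (forall e, e \in E' -> #|e| = 3 -> e \in E) -> exists S, splits S E'.
  move=> sz' w' a' sub; apply: IH => //; first exact: leq_trans w' En.
  by move=> K; apply: nK; apply: has_complete_sub K.
have del e : e \in E -> exists S, splits S (E :\ e).
  move=> eE; apply: lt.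
  - by move=> f; rewrite !inE => /andP[_ /Esz].
  - rewrite /weight (big_setD1 e eE) /= -[X in X < _]add0n ltn_add2r.
    by case/andP: (Esz e eE) => e2 _; apply: leq_trans e2.
  - by move=> C; apply: acyc; apply: lcycle_sub C => f; rewrite !inE => /andP[].
  by move=> f; rewrite !inE => /andP[].
have anti e f : e \in E -> f \in E -> e \subset f -> e = f.
  move=> eE fE ef; apply/eqP/negPn/negP=> nef; apply: nS.
  have [S Sf] := del f fE; exists S => g gE.
  case: (eqVneq g f) => [->|gf]; last by apply: Sf; rewrite !inE gf.
  have /andP[eS eS'] : ~~ (e \subset S) && ~~ (e \subset ~: S) by apply: Sf; rewrite !inE nef.
  by rewrite (contra (subset_trans ef) eS) (contra (subset_trans ef) eS').
have priv e v : e \in E -> v \in e -> exists2 f, f \in E &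
    v \in f /\ forall w, w \in f -> w \in e -> w = v.
  move=> eE ve; apply: private_edge nS (del e eE) => //.
  by move=> f /Esz /andP[].
have det s t p : tri E s t p -> exists Q, [/\ lpath s Q t, {subset Q <= E} & 2 <= size Q].
  case/and4P=> st sp tp pE; set g := [set s; t].
  (* In E' the edge g = st replaces all the edges that contain it. *)
  pose D := [set e in E | ~~ (g \subset e)]; pose E' := g |: D.
  have gg : g \notin D by rewrite inE subxx andbF.
  have c2 : #|g| = 2 by rewrite cards2 st.
  have lE' : lcycle E'.
    apply: NNPP => nl; apply: nS.
    have [||//||S SE'] := lt E'.
    - by move=> e; rewrite !inE => /orP[/eqP->|/andP[/Esz]//]; rewrite c2.
    - have -> : weight E' = 2 + \sum_(e in E | ~~ (g \subset e)) #|e|.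
        rewrite /weight big_setU1 //= c2; congr (_ + _).
        by apply: eq_bigl => e; rewrite inE.
      rewrite /weight [X in _ < X](bigID (fun e => g \subset e)) /= ltn_add2r.
      by rewrite (bigD1 [set s; t; p]) ?pE ?subsetUl //= card_set3.
    - by move=> e; rewrite !inE => /orP[/eqP->|/andP[]//]; rewrite c2.
    exists S => e eE; case: (boolP (g \subset e)) => ge.
      have /andP[gS gS'] := SE' g (setU11 _ _).
      by rewrite (contra (subset_trans ge) gS) (contra (subset_trans ge) gS').
    by apply: SE'; rewrite !inE eE ge orbT.
  case: (lE') => x [P [y [h [[xP PE' sP xy hE'] [xh yh hP]]]]].
  case: (boolP (g \in h :: P)) => gP; last first.
    case: acyc; exists x, P, y, h; move: gP; rewrite inE negb_or => /andP[gh gP].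
    split=> //; split=> //.
      move=> k kP; have := PE' k kP; rewrite !inE => /orP[/eqP kg|/andP[]//].
      by rewrite -kg kP in gP.
    by move: hE'; rewrite !inE [h == g]eq_sym (negPf gh) /= => /andP[].
  have [u [v [Q [[uQ sQ ug vg uv] QE']]]] := lcycle_rot xP PE' sP xy hE' xh yh hP gP.
  have QE : {subset Q <= E}.
    move=> k kQ; have := QE' k kQ; rewrite !inE => /orP[/eqP kg|/andP[]//].
    by move: sQ; rewrite (lpath_both uQ kQ) ?kg.
  move: ug vg; rewrite !inE => /orP[]/eqP Eu /orP[]/eqP Ev; subst u v.
  - by rewrite eqxx in uv.
  - by exists Q.
  - exists (rev Q); split; first exact: lpath_rev.
      by move=> k; rewrite mem_rev => /QE.
    by rewrite size_rev.
  by rewrite eqxx in uv.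
apply: nK; apply: (critical_complete Esz acyc anti priv det).
apply/eqP=> E0; apply: nS; exists set0 => e; by rewrite E0 inE.
Qed.

Lemma has_complete_embeds E : has_complete E ->
  contains_subhypergraph E (complete_hypergraph 5 3).
Proof.
case=> U [uU sU UT].
have x0 : V by case: (U) sU => [|x].
exists (fun i : 'I_5 => nth x0 U i); split.
  by move=> i j /eqP; rewrite nth_uniq ?sU // => /eqP /val_inj.
move=> h; rewrite inE => /eqP h3.
have /card_gt0P[i ih] : 0 < #|h| by rewrite h3.
have [j [jh ji _]] := third_vertex i i h3; have [k [kh ki kj]] := third_vertex i j h3.
have ij : i != j by rewrite eq_sym.
have ik : i != k by rewrite eq_sym.
have jk : j != k by rewrite eq_sym.
have -> : h = [set i; j; k] by apply: eq_set3; rewrite ?h3.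
rewrite !imsetU !imset_set1.
suff /and4P[] : tri E (nth x0 U i) (nth x0 U j) (nth x0 U k) by [].
by apply: UT; rewrite ?mem_nth ?nth_uniq ?sU.
Qed.
End Reduction.

Theorem theorem2 (V : finType) (E : {set {set V}}) :
  uniform 3 E ->
  ~ has_linear_cycle E ->
  ~ contains_subhypergraph E (complete_hypergraph 5 3) ->
  colorable 2 E.
Proof.
move=> E3 acyc nK.
have [||||S SE] := @splits_or V E (weight E).+1.
- by move=> e /E3 ->.
- by [].
- by move/lcycle_has_linear_cycle.
- by move/has_complete_embeds.
exists (fun v => if v \in S then ord0 else ord_max) => h hE [a ha].
have /andP[/subsetPn[v vh vS] /subsetPn[w wh]] := SE h hE.
rewrite inE negbK => wS; have := ha w wh; rewrite -(ha v vh) wS (negPf vS).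
by move/(congr1 val).
Qed.
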